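(* Fix $z_0>0$ and $\delta\in(0,1)$. Let $\alpha$ and $\beta$ be complex, independent Gaussian random variables with zero mean and variances $\mathbb{E}|\alpha|^2=\sigma_\alpha^2>\sigma_\beta^2=\mathbb{E}|\beta|^2$. Let $u$ be the solution to $$ i\,\partial_t u+\partial_x^2 u=2\cos(2x)\,|u|^2u,\quad x\in\mathbb{T},\qquad u(0,x)=\varepsilon\,(\alpha e^{ix}+\beta e^{-ix}). $$ Then for times $t=t(\varepsilon)$ such that $\lim_{\varepsilon\to0^+}\varepsilon^{2(1-\delta)}t=0$, we have $$\lim_{\varepsilon\to0^+}\varepsilon^{2\delta}\log\mathbb{P}\Big(\sup_{x\in\mathbb{T}}|u(t,x)|\ge z_0\,\varepsilon^{1-\delta}\Big)=-\frac{z_0^2}{\sigma_\alpha^2+\sigma_\beta^2}.$$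
   Context: $\mathbb{T}=[0,2\pi]$ with periodic boundary conditions. The equation is globally well-posed for initial data in $L^2(\mathbb{T})$, so $u$ is almost surely defined for all times; times are nonnegative. A complex Gaussian random variable $\eta$ with zero mean and variance $\mathbb{E}|\eta|^2=\sigma^2>0$ is circularly symmetric; in particular $|\eta|$ is Rayleigh distributed with density $\frac{2a}{\sigma^2}e^{-a^2/\sigma^2}$, $a\ge0$. *)

(* Defs.v *)
From HB Require Import structures.
From mathcomp Require Import all_boot all_order all_algebra.
From mathcomp Require Import all_classical all_reals all_analysis.
From mathcomp Require Import complex.

Set Implicit Arguments.
Unset Strict Implicit.
Unset Printing Implicit Defensive.

Import Order.TTheory GRing.Theory Num.Theory.
Import numFieldNormedType.Exports.
Import ComplexField.Normc.

Local Open Scope classical_set_scope.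
Local Open Scope ring_scope.
Local Open Scope complex_scope.

Section complex_functions.
Context {R : realType}.
Implicit Types (f : R -> R[i]) (x y : R).

(* [e^(iy)] *)
Definition cexpi y : R[i] := cos y +i* sin y.

(* Functions from the real line to [R[i]], identified with R^2, are
   differentiated componentwise. *)
Definition cderivable f x : Prop :=
  derivable (fun y => complex.Re (f y)) x 1 /\
  derivable (fun y => complex.Im (f y)) x 1.

Definition cderive1 f x : R[i] :=
  derive1 (fun y => complex.Re (f y)) x +i*
  derive1 (fun y => complex.Im (f y)) x.

Definition ccontinuous_on (D : set (R * R)) (g : R -> R -> R[i]) : Prop :=
  {within D, continuous (fun p : R * R => complex.Re (g p.1 p.2))} /\
  {within D, continuous (fun p : R * R => complex.Im (g p.1 p.2))}.

End complex_functions.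

Section equation.
Context {R : realType}.
Implicit Types (u : R -> R -> R[i]).

Definition dt u (t x : R) : R[i] := cderive1 (fun s => u s x) t.
Definition dx u (t x : R) : R[i] := cderive1 (u t) x.
Definition dxx u : R -> R -> R[i] := dx (dx u).

(* [u t x] is the global classical solution of
     i u_t + u_xx = 2 cos(2x) |u|^2 u,   u(0, x) = u0 x,
   where functions on the circle are 2 pi-periodic functions on the real line.
   [u] and [u_xx] are continuous up to time 0, hence so is [u_t] by the equation.
   Only the values of [u t] for t >= 0 matter. *)
Definition nls_solution (u0 : R -> R[i]) u : Prop :=
  [/\ forall x, u 0 x = u0 x,
      forall t x, 0 <= t -> u t (x + 2 * pi) = u t x,
      forall t x, 0 <= t -> cderivable (u t) x /\ cderivable (dx u t) x,
      ccontinuous_on [set p | 0 <= p.1] u /\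
      ccontinuous_on [set p | 0 <= p.1] (dxx u)
    & forall t x, 0 < t ->
        cderivable (fun s => u s x) t /\
        'i * dt u t x + dxx u t x =
          (2 * cos (2 * x) * normc (u t x) ^+ 2)%:C * u t x].

Definition sup_torus (f : R -> R[i]) : R :=
  sup [set normc (f x) | x in `[0, 2 * pi]].

End equation.

Section random_variables.
Context {d : measure_display} {T : measurableType d} {R : realType}.
Variable P : probability T R.
Implicit Types (eta : T -> R[i]).

Definition re_im eta (w : T) : R * R :=
  (complex.Re (eta w), complex.Im (eta w)).

(* Centred circularly symmetric complex Gaussian with E|eta|^2 = s ^+ 2: the real
   and imaginary parts are independent real Gaussians of variance s ^+ 2 / 2.
   The second parameter of [normal_prob] is the standard deviation. *)
Definition complex_gaussian (s : R) eta : Prop :=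
  measurable_fun setT (re_im eta) /\
  forall A : set (R * R), measurable A ->
    P (re_im eta @^-1` A) =
    (normal_prob 0 (s / Num.sqrt 2) \x normal_prob 0 (s / Num.sqrt 2))%E A.

Definition independent_complex eta eta' : Prop :=
  forall A B : set (R * R), measurable A -> measurable B ->
    P (re_im eta @^-1` A `&` re_im eta' @^-1` B) =
    (P (re_im eta @^-1` A) * P (re_im eta' @^-1` B))%E.

End random_variables.

(* Main.v *)
Require Import Defs.
From HB Require Import structures.
From mathcomp Require Import all_boot all_order all_algebra.
From mathcomp Require Import all_classical all_reals all_analysis.
From mathcomp Require Import measurable_realfun complex.
From mathcomp Require Import ring lra.

Set Implicit Arguments.
Unset Strict Implicit.
Unset Printing Implicit Defensive.

Import Order.TTheory GRing.Theory Num.Theory.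
Import numFieldNormedType.Exports.

Local Open Scope classical_set_scope.
Local Open Scope ring_scope.
Local Open Scope complex_scope.

(** The threshold [z0 eps^(1-delta)] is far above the typical size [eps] of the
    data, so exceeding it requires Gaussian amplitudes of size [eps^(-delta)]; the
    solution then has size [eps^(1-delta)], and its cubic nonlinearity needs a time
    of order [eps^(-2(1-delta))] to act. At the much shorter times considered here
    the solution is a perturbation of the free one, whose modulus is that of the
    data, with supremum [eps (|alpha| + |beta|)]. The statement is therefore a large
    deviation estimate for [|alpha| + |beta|].

    Comparison with the free flow. Write [u = p + i q] and let [rho = p^2 + q^2].
    The equation conserves the mass, the integral of [rho], and the energy, the
    integral of [|u_x|^2 + cos(2x) rho^2] ([mass_conserved], [energy_conserved]).
    Agmon's inequality turns the two conservation laws into a bound of the sup norm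
    and of the kinetic energy that holds for all times ([apriori]), hence no
    continuation argument is needed. For the difference [w] of two flows the
    dispersive terms cancel in the derivative of the mass ([is_derive_mass]), so
    Gronwall's inequality controls the L^2 norm of [w]; the kinetic energy of [w] is
    bounded because both flows have bounded kinetic energy, and Agmon's inequality
    interpolates between the two to make the sup norm of [w] small. With the free
    flow as second flow this gives [nls_near_free] and [nls_near_trig]; with another
    solution it gives continuous dependence on the data ([nls_stability],
    [nls_solution_stability]).

    Measurability. The solution is only given pointwise in the probability space.
    By continuous dependence the sup norm at a fixed time is a continuous function
    of the two amplitudes on the set of values that they take, and this makes the
    event measurable ([measurable_exceed]).

    Upper bound. By the Cauchy-Schwarz inequality
    [(|alpha| + |beta|)^2 <= (sa^2 + sb^2) (|alpha|^2/sa^2 + |beta|^2/sb^2)], so the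
    event forces the last factor to be at least about
    [z0^2 eps^(-2 delta) / (sa^2 + sb^2)] ([exceed_imp_large]). That factor is a sum
    of four independent quantities whose tails decay at the exponential rate 1, and
    so does the tail of the sum ([exp_tail_add], [data_tail]).

    Lower bound. It is enough that [alpha] and [beta] have nearly real positive values
    in the proportion [sa^2 : sb^2], which is the equality case of Cauchy-Schwarz;
    evaluation at [x = 0] then shows that the threshold is exceeded
    ([box_imp_exceed]), and the probability of such a box is explicit
    ([data_box]). *)

(** * Integration over one period *)

Section circle.
Context {R : realType}.
Implicit Types (f g : R -> R) (F : R -> R -> R).
Local Notation mu := (@lebesgue_measure R).

Definition circ f : R := \int[mu]_(x in `[0, 2 * pi]) f x.

Definition jcont F : Prop := continuous (fun p : R * R => F p.1 p.2).

Lemma twopi_gt0 : 0 < 2 * pi :> R.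
Proof. by rewrite mulr_gt0// pi_gt0. Qed.

Lemma circ_integrable f : continuous f ->
  mu.-integrable `[0, 2 * pi] (EFin \o f).
Proof.
move=> cf; apply: continuous_compact_integrable; first exact: segment_compact.
exact: continuous_subspaceT.
Qed.

Lemma circD f g : continuous f -> continuous g ->
  circ (fun x => f x + g x) = circ f + circ g.
Proof. by move=> cf cg; rewrite /circ RintegralD//; exact: circ_integrable. Qed.

Lemma circB f g : continuous f -> continuous g ->
  circ (fun x => f x - g x) = circ f - circ g.
Proof. by move=> cf cg; rewrite /circ RintegralB//; exact: circ_integrable. Qed.

Lemma circZ k f : continuous f -> circ (fun x => k * f x) = k * circ f.
Proof. by move=> cf; rewrite /circ RintegralZl//; exact: circ_integrable. Qed.

Lemma circ_cst (k : R) : circ (fun=> k) = k * (2 * pi).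
Proof.
rewrite /circ Rintegral_cst//; congr (_ * _).
have := @lebesgue_measure_itv R `[0, 2 * pi]; rewrite /= lte_fin twopi_gt0 sube0.
by move=> E; exact: (congr1 fine E).
Qed.

Lemma eq_circ f g : (forall x, f x = g x) -> circ f = circ g.
Proof. by move=> fg; congr circ; apply/funext. Qed.

Lemma le_circ f g : continuous f -> continuous g ->
  (forall x, 0 <= x <= 2 * pi -> f x <= g x) -> circ f <= circ g.
Proof.
move=> cf cg fg; apply: le_Rintegral => //; exact: circ_integrable.
Qed.

Lemma circ_ge0 f : (forall x, 0 <= f x) -> 0 <= circ f.
Proof. by move=> f0; apply: Rintegral_ge0. Qed.

Lemma is_derive_continuous (f df : R -> R) :
  (forall x : R, is_derive x 1 f (df x)) -> continuous f.
Proof.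
move=> dfx x; apply: differentiable_continuous; apply/derivable1_diffP.
by have [] := dfx x.
Qed.

Lemma circ_derive f df : continuous df ->
  (forall x : R, is_derive x 1 f (df x)) -> circ df = f (2 * pi) - f 0.
Proof.
move=> cdf dfx; rewrite /circ /Rintegral.
have cf := is_derive_continuous dfx.
rewrite (@continuous_FTC2 _ df f) ?twopi_gt0//.
- exact: continuous_subspaceT.
- split.
  + by move=> x _; have [] := dfx x.
  + exact/cvg_at_right_filter/cf.
  + exact/cvg_at_left_filter/cf.
- by move=> x _; rewrite derive1E; have [_ ->] := dfx x.
Qed.

(** Dominated convergence holds for sequences; a limit along a punctured
    neighbourhood is a limit along all sequences in it, and the domination is valid
    from some rank on along each of them. *)
Lemma circ_cvg F (l : R -> R) t0 (M : R) :
  (forall t, continuous (F t)) ->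
  (\forall t \near t0^', forall x, 0 <= x <= 2 * pi -> `|F t x| <= M) ->
  (forall x, 0 <= x <= 2 * pi -> F t x @[t --> t0^'] --> l x) ->
  circ (F t) @[t --> t0^'] --> circ l.
Proof.
move=> cF Fb Fl; apply/cvgr_dnbhsP => u ut.
have /cvgr_dnbhsP ubnd : (fun t => if `[< forall x, 0 <= x <= 2 * pi -> `|F t x| <= M >] then 0 else 1 : R) t @[t --> t0^'] --> (0 : R).
  apply/cvgrPdist_le => e e0; near=> t.
  by case: asboolP => [_|[]]; [rewrite subrr normr0 ltW|near: t].
have /cvgrPdist_lt /(_ 1 ltr01) [N _ uN] := ubnd _ ut.
have {}uN n x : 0 <= x <= 2 * pi -> `|F (u (n + N)%N) x| <= M.
  move=> xI; have /= := uN (n + N)%N (leq_addl _ _).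
  by case: asboolP => [/(_ _ xI)//|_]; rewrite sub0r normrN normr1 ltxx.
rewrite -(cvg_shiftn N) /=.
apply: fine_cvg.
have mF n : measurable_fun `[0, 2 * pi] (F (u (n + N)%N)).
  apply/measurable_EFinP.
  by have /integrableP[] := circ_integrable (cF (u (n + N)%N)).
have Fl' x : `[0, 2 * pi]%classic x -> F (u (n + N)%N) x @[n --> \oo] --> l x.
  move=> /=; rewrite in_itv/= => xI.
  have /cvgr_dnbhsP/(_ _ ut) := Fl x xI.
  by rewrite -(cvg_shiftn N).
have ml : measurable_fun `[0, 2 * pi] l by exact: measurable_fun_cvg Fl'.
have mEF n : measurable_fun `[0, 2 * pi] (EFin \o F (u (n + N)%N)).
  exact/measurable_EFinP.
have mEl : measurable_fun `[0, 2 * pi] (EFin \o l) by exact/measurable_EFinP.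
have ae_cvg : \forall x \ae mu, `[0, 2 * pi]%classic x ->
    (EFin \o F (u (n + N)%N)) x @[n --> \oo] --> (EFin \o l) x.
  by apply/aeW => x /Fl' xl; apply: cvg_EFin; first exact: nearW.
have ae_le : \forall x \ae mu, forall n, `[0, 2 * pi]%classic x ->
    (`|(EFin \o F (u (n + N)%N)) x| <= (EFin \o cst M) x)%E.
  by apply/aeW => x n /=; rewrite in_itv/= lee_fin => /uN.
have intM : mu.-integrable `[0, 2 * pi] (EFin \o cst M).
  by apply: circ_integrable; exact: cst_continuous.
have [intl _ Fcvg] := @dominated_convergence _ _ _ mu _ (measurable_itv _) _ _ _ mEF mEl ae_cvg
  intM ae_le.
rewrite fineK; last exact: integrable_fin_num intl.
exact: Fcvg.
Unshelve. all: end_near. Qed.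

Lemma jcont_slice F t : jcont F -> continuous (F t).
Proof.
move=> cF x; apply: (@continuous2_cvg _ _ _ _ _ _ (cst t) id F).
- exact: (cF (t, x)).
- exact: cvg_cst.
- exact: cvg_id.
Qed.

Lemma jcont_trace F x : jcont F -> continuous (F ^~ x).
Proof.
move=> cF t; apply: (@continuous2_cvg _ _ _ _ _ _ id (cst x) F).
- exact: (cF (t, x)).
- exact: cvg_id.
- exact: cvg_cst.
Qed.

(** The slab is compact. *)
Lemma jcont_bounded F (a b : R) : jcont F ->
  exists2 M, 0 <= M &
    forall t x, a <= t <= b -> 0 <= x <= 2 * pi -> `|F t x| <= M.
Proof.
move=> cF; have [ab|ba] := lerP a b; last first.
  exists 0 => // t x /andP[at_ tb].
  by have := le_trans at_ tb; rewrite leNgt ba.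
pose K : set (R * R) := `[a, b]%classic `*` `[0, 2 * pi]%classic.
have K0 : K !=set0.
  by exists (a, 0); split; rewrite /= in_itv/= lexx ?(ltW twopi_gt0) ?ab.
have cK : compact K by apply: compact_setX; exact: segment_compact.
have cN : {within K, continuous (fun p => `|F p.1 p.2|)}.
  apply: continuous_subspaceT => p.
  by apply: continuous_comp; [exact: cF|exact: norm_continuous].
have [[c1 c2] _ cmax] := compact_EVT_max K0 cK cN.
exists (`|F c1 c2|) => // t x tab xI.
by apply: (cmax (t, x)); rewrite inE; split; rewrite /= in_itv.
Qed.

Lemma continuous_dnbhs f t : {for t, continuous f} ->
  f s @[s --> t^'] --> f t.
Proof. by move=> cf A /cf; exact: nbhs_dnbhs. Qed.

Lemma circ_continuous F : jcont F -> continuous (fun t => circ (F t)).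
Proof.
move=> cF t0; apply/continuous_withinNx.
have [M M0 FM] := jcont_bounded (t0 - 1) (t0 + 1) cF.
apply: (@circ_cvg _ _ _ M).
- by move=> t; exact: jcont_slice.
- apply: nbhs_dnbhs; apply: filterS (nbhsx_ballx t0 1 ltr01) => t.
  by rewrite /ball/= ltr_distlC => /andP[t1 t2] x xI; apply: FM => //; lra.
- by move=> x xI; apply: continuous_dnbhs; exact: jcont_trace.
Qed.
End circle.

(** * Differentiation under the integral, integration by parts, interpolation *)

Section calculus.
Context {R : realType}.
Implicit Types (f g : R -> R) (F Ft G : R -> R -> R).
Local Notation mu := (@lebesgue_measure R).

Lemma cvg_quotient f (t l : R) : is_derive t 1 f l ->
  (f s - f t) / (s - t) @[s --> t^'] --> l.
Proof.
move=> /is_derive1_caratheodory[g [fg cg <-]].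
have := continuous_dnbhs cg; apply: cvg_trans; apply: near_eq_cvg.
near=> s; rewrite fg mulfK// subr_eq0.
by near: s; exact: nbhs_dnbhs_neq.
Unshelve. all: end_near. Qed.

Lemma is_derive_quotient f (t l : R) :
  (f s - f t) / (s - t) @[s --> t^'] --> l -> is_derive t 1 f l.
Proof.
move=> fl; apply/is_derive1_caratheodory.
exists (fun s => if s == t then l else (f s - f t) / (s - t)); split.
- move=> s; case: eqVneq => [->|st]; first by rewrite !subrr mulr0.
  by rewrite divfK// subr_eq0.
- apply/continuous_withinNx; rewrite eqxx.
  apply: cvg_trans fl; apply: near_eq_cvg; near=> s.
  have : s != t by near: s; exact: nbhs_dnbhs_neq.
  by move=> /negPf ->.
- by rewrite eqxx.
Unshelve. all: end_near. Qed.

Lemma continuous_add f g : continuous f -> continuous g ->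
  continuous (fun x => f x + g x).
Proof. by move=> cf cg x; exact: continuousD (cf x) (cg x). Qed.

Lemma continuous_sub f g : continuous f -> continuous g ->
  continuous (fun x => f x - g x).
Proof. by move=> cf cg x; exact: continuousB (cf x) (cg x). Qed.

Lemma continuous_mul f g : continuous f -> continuous g ->
  continuous (fun x => f x * g x).
Proof. by move=> cf cg x; exact: continuousM (cf x) (cg x). Qed.

Lemma continuous_sqr f : continuous f -> continuous (fun x => f x ^+ 2).
Proof.
move=> cf; rewrite (_ : (fun _ => _) = (fun x => f x * f x)).
  exact: continuous_mul.
by apply/funext => x; rewrite expr2.
Qed.

Lemma continuous_scale k f : continuous f -> continuous (fun x => k * f x).
Proof. by move=> cf; apply: continuous_mul => //; exact: cst_continuous. Qed.

Lemma continuous_opp f : continuous f -> continuous (fun x => - f x).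
Proof. by move=> cf x; exact: continuousN (cf x). Qed.

Lemma jcontD F G : jcont F -> jcont G -> jcont (fun t x => F t x + G t x).
Proof. by move=> cf cg x; exact: continuousD (cf x) (cg x). Qed.

Lemma jcontB F G : jcont F -> jcont G -> jcont (fun t x => F t x - G t x).
Proof. by move=> cf cg x; exact: continuousB (cf x) (cg x). Qed.

Lemma jcontM F G : jcont F -> jcont G -> jcont (fun t x => F t x * G t x).
Proof. by move=> cf cg x; exact: continuousM (cf x) (cg x). Qed.

Lemma jcontN F : jcont F -> jcont (fun t x => - F t x).
Proof. by move=> cf x; exact: continuousN (cf x). Qed.

Lemma jcontX F n : jcont F -> jcont (fun t x => F t x ^+ n).
Proof.
move=> cf; elim: n => [|n IH]; first exact: cst_continuous.
rewrite (_ : (fun t x => _) = (fun t x => F t x * F t x ^+ n)); first exact: jcontM.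
by apply/funext => t; apply/funext => x; rewrite exprS.
Qed.

Lemma jcontZ k F : jcont F -> jcont (fun t x => k * F t x).
Proof. by move=> cf x; apply: continuousM (cf x); exact: cst_continuous. Qed.

Lemma jcont_space f : continuous f -> jcont (fun t x => f x).
Proof.
move=> cf [t x]; apply: (@continuous_comp _ _ _ snd f); first exact: cvg_snd.
exact: cf.
Qed.

(** By the mean value theorem the difference quotients are values of [Ft] at
    intermediate times, which stay in a compact set. *)
Lemma quotient_bounded F Ft (t : R) : jcont Ft ->
  (forall s x : R, 0 < s -> is_derive s 1 (F ^~ x) (Ft s x)) -> 0 < t ->
  exists M, \forall s \near t^', forall x, 0 <= x <= 2 * pi ->
    `|(F s x - F t x) / (s - t)| <= M.
Proof.
move=> cFt dF t0.
have [M M0 FM] := jcont_bounded (t / 2) (t + t / 2) cFt.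
exists M; near=> s => x xI.
have st : s != t by near: s; exact: nbhs_dnbhs_neq.
have : `|t - s| < t / 2.
  near: s; apply: nbhs_dnbhs; apply: nbhsx_ballx; lra.
rewrite ltr_distlC => /andP[s1 s2].
have df (a b : R) : 0 < a -> a < b -> t / 2 <= a -> b <= t + t / 2 ->
    `|(F b x - F a x) / (b - a)| <= M.
  move=> a0 ab ta bt.
  have [||c] := @MVT R (F ^~ x) (Ft ^~ x) a b ab.
  - by move=> c; rewrite in_itv/= => /andP[ac _]; apply: dF; lra.
  - apply: derivable_within_continuous => c; rewrite in_itv/= => /andP[ac _].
    by have [] := dF c x _; first lra.
  rewrite in_itv/= => /andP[ac cb] ->.
  rewrite mulfK ?subr_eq0 ?gt_eqF//; apply: FM => //; lra.
have [ts|ts] := ltP t s; first by apply: df; lra.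
rewrite -[X in `|X|]mulrNN -invrN !opprB; apply: df; lra.
Unshelve. all: end_near. Qed.

Lemma is_derive_circ F Ft (t : R) : jcont F -> jcont Ft ->
  (forall s x : R, 0 < s -> is_derive s 1 (F ^~ x) (Ft s x)) -> 0 < t ->
  is_derive t 1 (fun s => circ (F s)) (circ (Ft t)).
Proof.
move=> cF cFt dF t0; apply: is_derive_quotient.
have [M FM] := quotient_bounded cFt dF t0.
rewrite (_ : (fun s => _) =
    (fun s => circ (fun x => (s - t)^-1 * (F s x - F t x)))); last first.
  apply/funext => s; have cs u : continuous (F u) by exact: jcont_slice.
  by rewrite circZ ?circB// 1?mulrC//; exact: continuous_sub.
apply: (@circ_cvg _ _ _ _ M).
- by move=> s; apply: continuous_scale; apply: continuous_sub; exact: jcont_slice.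
- by apply: filterS FM => s sM x xI; rewrite mulrC; exact: sM.
- move=> x xI; under eq_fun do rewrite mulrC.
  exact/cvg_quotient/dF.
Qed.

(** Green's formula on the circle: periodicity removes the boundary terms. *)
Lemma circ_green (f fx fxx g gx gxx : R -> R) :
  continuous fxx -> continuous gxx ->
  (forall x : R, is_derive x 1 f (fx x)) -> (forall x : R, is_derive x 1 fx (fxx x)) ->
  (forall x : R, is_derive x 1 g (gx x)) -> (forall x : R, is_derive x 1 gx (gxx x)) ->
  f (2 * pi) = f 0 -> fx (2 * pi) = fx 0 -> g (2 * pi) = g 0 -> gx (2 * pi) = gx 0 ->
  circ (fun x => f x * gxx x) = circ (fun x => fxx x * g x).
Proof.
move=> cfxx cgxx df dfx dg dgx pf pfx pg pgx.
have cf := is_derive_continuous df; have cg := is_derive_continuous dg.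
apply/eqP; rewrite -subr_eq0 -circB; [|exact: continuous_mul..].
have dW (x : R) : is_derive x 1 (fun x => f x * gx x - fx x * g x)
    (f x * gxx x - fxx x * g x).
  by apply: is_derive_eq; rewrite /GRing.scale/=; ring.
rewrite (circ_derive _ dW); first by rewrite pf pfx pg pgx subrr.
by apply: continuous_sub; exact: continuous_mul.
Qed.

Lemma circ_by_parts (f fx fxx : R -> R) : continuous fxx ->
  (forall x : R, is_derive x 1 f (fx x)) -> (forall x : R, is_derive x 1 fx (fxx x)) ->
  f (2 * pi) = f 0 -> fx (2 * pi) = fx 0 ->
  circ (fun x => fx x ^+ 2) = - circ (fun x => f x * fxx x).
Proof.
move=> cfxx df dfx pf pfx.
have cf := is_derive_continuous df; have cfx := is_derive_continuous dfx.
apply/eqP; rewrite -subr_eq0 opprK -circD; [|exact: continuous_sqr|exact: continuous_mul].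
have dW (x : R) : is_derive x 1 (fun x => f x * fx x) (fx x ^+ 2 + f x * fxx x).
  by apply: is_derive_eq; rewrite /GRing.scale/=; ring.
rewrite (circ_derive _ dW); first by rewrite pf pfx subrr.
by apply: continuous_add; [exact: continuous_sqr|exact: continuous_mul].
Qed.

(** The increment is the integral of the derivative over a subinterval, and [h] is
    nonnegative. *)
Lemma increment_le_circ (f df h : R -> R) (a b : R) :
  continuous df -> continuous h -> (forall x : R, is_derive x 1 f (df x)) ->
  (forall x, `|df x| <= h x) -> 0 <= a <= 2 * pi -> 0 <= b <= 2 * pi ->
  f b - f a <= circ h.
Proof.
move=> cdf ch dfx dh aI bI.
have cf := is_derive_continuous dfx.
have h0 x : 0 <= h x by exact: le_trans (dh x).
have main (g dg : R -> R) (c d : R) : continuous g -> continuous dg ->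
    (forall x : R, is_derive x 1 g (dg x)) -> (forall x, dg x <= h x) ->
    0 <= c -> c < d -> d <= 2 * pi -> g d - g c <= circ h.
  move=> cg cdg dgx dgh c0 cd d2pi.
  have <- : \int[mu]_(x in `[c, d]) dg x = g d - g c.
    rewrite /Rintegral (@continuous_FTC2 _ dg g)//.
    - exact: continuous_subspaceT.
    - split.
      + by move=> x _; have [] := dgx x.
      + exact/cvg_at_right_filter/cg.
      + exact/cvg_at_left_filter/cg.
    - by move=> x _; rewrite derive1E; have [_ ->] := dgx x.
  have cint k : continuous k -> mu.-integrable `[c, d] (EFin \o k).
    move=> ck; apply: continuous_compact_integrable; first exact: segment_compact.
    exact: continuous_subspaceT.
  apply: (@le_trans _ _ (\int[mu]_(x in `[c, d]) h x)).
    by apply: le_Rintegral => //; exact: cint.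
  have hI := circ_integrable ch.
  apply: fine_le.
  - by apply: integrable_fin_num => //; exact: cint.
  - exact: integrable_fin_num.
  - apply: ge0_subset_integral => //.
    + by have /integrableP[] := hI.
    + by move=> x _; rewrite lee_fin.
    + by apply: subset_itv; rewrite bnd_simp.
have [ab|ba|<-] := ltgtP a b; last by rewrite subrr circ_ge0.
- apply: (main f df) => //; [|lra..].
  by move=> x; exact: le_trans (ler_norm _) (dh x).
- rewrite -[f b](opprK) addrC.
  apply: (main (fun x => - f x) (fun x => - df x)) => //;
    [exact: continuous_opp|exact: continuous_opp| |lra..].
  by move=> x; apply: le_trans (dh x); rewrite -normrN ler_norm.
Qed.

(** Agmon's inequality in one dimension, with a free parameter [m] in place of a
    product of norms: at its minimum [f ^+ 2] is at most its mean value, and the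
    increments of [f ^+ 2] are controlled by [2 |f f'| <= m f^2 + f'^2 / m]. *)
Lemma agmon (f fx : R -> R) (m x : R) : continuous fx ->
  (forall x : R, is_derive x 1 f (fx x)) -> 0 < m -> 0 <= x <= 2 * pi ->
  f x ^+ 2 <= (1 + m) * circ (fun y => f y ^+ 2) + circ (fun y => fx y ^+ 2) / m.
Proof.
move=> cfx dfx m0 xI.
have cf := is_derive_continuous dfx.
have cf2 := continuous_sqr cf; have cfx2 := continuous_sqr cfx.
have [y] := EVT_min (ltW twopi_gt0) (continuous_subspaceT cf2 : {within `[0, 2 * pi], continuous _}).
rewrite in_itv/= => yI ymin.
have fy : f y ^+ 2 <= circ (fun y => f y ^+ 2).
  apply: (@le_trans _ _ (f y ^+ 2 * (2 * pi))).
    rewrite ler_peMr ?sqr_ge0//; have := pi_ge2 R; lra.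
  rewrite -circ_cst; apply: le_circ => //; exact: cst_continuous.
pose h z := m * f z ^+ 2 + m^-1 * fx z ^+ 2.
have ch : continuous h by apply: continuous_add; exact: continuous_scale.
have ->: circ (fun y => fx y ^+ 2) / m = m^-1 * circ (fun y => fx y ^+ 2).
  exact: mulrC.
have hE : circ h =
    m * circ (fun y => f y ^+ 2) + m^-1 * circ (fun y => fx y ^+ 2).
  by rewrite circD ?circZ//; exact: continuous_scale.
have df2 (z : R) : is_derive z 1 (fun z => f z ^+ 2) (2 * (f z * fx z)).
  by apply: is_derive_eq; rewrite /GRing.scale/=; ring.
(* the expanded squares [(m f +- f')^2 / m >= 0] *)
have h_ge z : `|2 * (f z * fx z)| <= h z.
  rewrite /h; have mi : m * m^-1 = 1 by rewrite divff ?gt_eqF.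
  have m1 : 0 < m^-1 by rewrite invr_gt0.
  have E1 := sqr_ge0 (m * f z + fx z); have E2 := sqr_ge0 (m * f z - fx z).
  have E3 : m^-1 * (m * f z + fx z) ^+ 2 =
    (m * m^-1) * m * f z ^+ 2 + m^-1 * fx z ^+ 2 + (m * m^-1) * 2 * (f z * fx z).
    by ring.
  have E4 : m^-1 * (m * f z - fx z) ^+ 2 =
    (m * m^-1) * m * f z ^+ 2 + m^-1 * fx z ^+ 2 - (m * m^-1) * 2 * (f z * fx z).
    by ring.
  have := mulr_ge0 (ltW m1) E1; have := mulr_ge0 (ltW m1) E2.
  rewrite E3 E4 mi ler_norml; lra.
have cdf2 : continuous (fun z => 2 * (f z * fx z)).
  by apply: continuous_scale; exact: continuous_mul.
have := increment_le_circ cdf2 ch df2 h_ge yI xI.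
rewrite hE; lra.
Qed.
End calculus.

(** * Conservation laws *)

Section waves.
Context {R : realType}.

(** One real component of a solution, together with its derivatives. Regularity in
    space is required at all real times, but the time derivative only at positive
    ones: a solution that starts at time 0 is extended to negative times by its
    initial value, which makes joint continuity a statement about the whole plane. *)
Record wave := Wave {
  val :> R -> R -> R;
  vx : R -> R -> R;
  vxx : R -> R -> R;
  vt : R -> R -> R;
  jcont_val : jcont val;
  jcont_vxx : jcont vxx;
  jcont_vt : jcont vt;
  is_derive_val : forall t x : R, is_derive x 1 (val t) (vx t x);
  is_derive_vx : forall t x : R, is_derive x 1 (vx t) (vxx t x);
  is_derive_vt : forall t x : R, 0 < t -> is_derive t 1 (val ^~ x) (vt t x);
  val_per : forall t : R, val t (2 * pi) = val t 0;
  vx_per : forall t : R, vx t (2 * pi) = vx t 0 }.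

Arguments jcont_val w x : clear implicits.
Arguments jcont_vxx w x : clear implicits.
Arguments jcont_vt w x : clear implicits.
Implicit Types (p q : wave).

Lemma continuous_val p t : continuous (p t).
Proof. by apply: jcont_slice; exact: jcont_val p. Qed.

Lemma continuous_vx p t : continuous (vx p t).
Proof. exact: is_derive_continuous (is_derive_vx p t). Qed.

Lemma continuous_vxx p t : continuous (vxx p t).
Proof. by apply: jcont_slice; exact: jcont_vxx p. Qed.

Lemma continuous_vt p t : continuous (vt p t).
Proof. by apply: jcont_slice; exact: jcont_vt p. Qed.

Arguments continuous_val p t x : clear implicits.
Arguments continuous_vx p t x : clear implicits.
Arguments continuous_vxx p t x : clear implicits.
Arguments continuous_vt p t x : clear implicits.

Program Definition wave_sub p q : wave :=
  @Wave (fun t x => p t x - q t x) (fun t x => vx p t x - vx q t x)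
    (fun t x => vxx p t x - vxx q t x) (fun t x => vt p t x - vt q t x)
    _ _ _ _ _ _ _ _.
Next Obligation. by move=> p q; apply: jcontB; exact: jcont_val. Qed.
Next Obligation. by move=> p q; apply: jcontB; exact: jcont_vxx. Qed.
Next Obligation. by move=> p q; apply: jcontB; exact: jcont_vt. Qed.
Next Obligation.
move=> p q t x; have := is_derive_val p t x; have := is_derive_val q t x.
by move=> dq dp; exact: is_deriveB.
Qed.
Next Obligation.
move=> p q t x; have := is_derive_vx p t x; have := is_derive_vx q t x.
by move=> dq dp; exact: is_deriveB.
Qed.
Next Obligation.
move=> p q t x t0; have := is_derive_vt p x t0; have := is_derive_vt q x t0.
by move=> dq dp; exact: (is_deriveB dp dq).
Qed.
Next Obligation. by move=> p q t; rewrite /= !val_per. Qed.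
Next Obligation. by move=> p q t; rewrite /= !vx_per. Qed.

Definition rho p q (t x : R) : R := p t x ^+ 2 + q t x ^+ 2.
Definition mass p q (t : R) : R := circ (rho p q t).
Definition kin1 p (t : R) : R := circ (fun x => vx p t x ^+ 2).
Definition kin p q (t : R) : R := kin1 p t + kin1 q t.
Definition quartic p q (t : R) : R := circ (fun x => cos (2 * x) * rho p q t x ^+ 2).
Definition pot p q (t x : R) : R := 2 * cos (2 * x) * rho p q t x.

(** The equation [i u_t + u_xx = 2 cos(2x) |u|^2 u] for [u = p + i q]. *)
Definition nls p q : Prop := forall t x, 0 < t ->
  vt p t x = - vxx q t x + pot p q t x * q t x /\
  vt q t x = vxx p t x - pot p q t x * p t x.

(** The free Schrodinger equation for [p + i q]. *)
Definition free p q : Prop := forall t x, 0 < t ->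
  vt p t x = - vxx q t x /\ vt q t x = vxx p t x.

Lemma rho_ge0 p q t x : 0 <= rho p q t x.
Proof. by rewrite addr_ge0 ?sqr_ge0. Qed.

Lemma mass_ge0 p q t : 0 <= mass p q t.
Proof. by apply: circ_ge0 => x; exact: rho_ge0. Qed.

Lemma jcont_rho p q : jcont (rho p q).
Proof. by apply: jcontD; apply: jcontX; exact: jcont_val. Qed.

Arguments jcont_rho p q x : clear implicits.

Lemma continuous_rho p q t : continuous (rho p q t).
Proof. by apply: jcont_slice; exact: jcont_rho p q. Qed.

Lemma continuous_cos2 : continuous (fun x : R => cos (2 * x)).
Proof.
apply: (@is_derive_continuous _ _ (fun x => - sin (2 * x) * 2)) => x.
have d2 : is_derive x 1 (fun x : R => 2 * x) 2.
  by apply: is_derive_eq; rewrite /GRing.scale/=; ring.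
exact: (is_derive1_comp (f := cos)).
Qed.

Lemma jcont_pot p q : jcont (pot p q).
Proof.
apply: (@jcontM _ (fun _ x => 2 * cos (2 * x)) (rho p q)); last exact: jcont_rho.
apply: (@jcont_space _ (fun x => 2 * cos (2 * x))).
by apply: continuous_scale; exact: continuous_cos2.
Qed.

Lemma jcont_quartic p q : jcont (fun t x => cos (2 * x) * rho p q t x ^+ 2).
Proof.
apply: (@jcontM _ (fun _ x => cos (2 * x)) (fun t x => rho p q t x ^+ 2)).
  exact: (jcont_space continuous_cos2).
by apply: jcontX; exact: jcont_rho.
Qed.

(** Only the forcing terms [a], [b] contribute to the growth of the mass: the
    contribution of the dispersion vanishes by Green's formula. *)
Lemma is_derive_mass p q (a b : R -> R -> R) (t : R) : jcont a -> jcont b ->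
  (forall t x, 0 < t -> vt p t x = - vxx q t x + a t x) ->
  (forall t x, 0 < t -> vt q t x = vxx p t x - b t x) -> 0 < t ->
  is_derive t 1 (mass p q) (circ (fun x => 2 * (p t x * a t x - q t x * b t x))).
Proof.
move=> ca cb Ep Eq t0.
have -> : circ (fun x => 2 * (p t x * a t x - q t x * b t x)) =
    circ (fun x => 2 * (p t x * vt p t x + q t x * vt q t x)).
  have cq := continuous_val q t; have cp := continuous_val p t.
  have cqxx := continuous_vxx q t; have cpxx := continuous_vxx p t.
  have cat : continuous (a t) by exact: jcont_slice.
  have cbt : continuous (b t) by exact: jcont_slice.
  have G := circ_green cqxx cpxx (is_derive_val q t) (is_derive_vx q t)
    (is_derive_val p t) (is_derive_vx p t) (val_per q t) (vx_per q t)
    (val_per p t) (vx_per p t).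
  have -> : circ (fun x => 2 * (p t x * vt p t x + q t x * vt q t x)) =
    circ (fun x => 2 * (p t x * a t x - q t x * b t x) +
                   2 * (q t x * vxx p t x - vxx q t x * p t x)).
    by apply: eq_circ => x; rewrite Ep// Eq//; ring.
  rewrite circD.
  - rewrite [X in _ + X]circZ; last by apply: continuous_sub; exact: continuous_mul.
    rewrite [X in _ + 2 * X]circB; [|exact: continuous_mul..].
    by rewrite G subrr mulr0 addr0.
  - by apply: continuous_scale; apply: continuous_sub; exact: continuous_mul.
  - by apply: continuous_scale; apply: continuous_sub; exact: continuous_mul.
apply: (@is_derive_circ _ (rho p q) (fun t x => 2 * (p t x * vt p t x + q t x * vt q t x))) => //.
- exact: jcont_rho.
- apply: jcontZ; apply: jcontD; apply: jcontM; first [exact: jcont_val|exact: jcont_vt].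
- move=> s x s0; have dp := is_derive_vt p x s0; have dq := is_derive_vt q x s0.
  by apply: is_derive_eq; rewrite /GRing.scale/=; ring.
Qed.

Lemma continuous_mass p q : continuous (mass p q).
Proof. exact/circ_continuous/jcont_rho. Qed.

Lemma derive0_eq (m : R -> R) (t : R) : continuous m ->
  (forall s : R, 0 < s -> is_derive s 1 m 0) -> 0 <= t -> m t = m 0.
Proof.
move=> cm dm; rewrite le_eqVlt => /predU1P[<-//|t0].
have [||c _] := @MVT R m (fun=> 0) 0 t t0.
- by move=> s; rewrite in_itv/= => /andP[s0 _]; exact: dm.
- exact: continuous_subspaceT.
- by rewrite mul0r => /eqP; rewrite subr_eq0 => /eqP.
Qed.

(** The function [exp(- l s) m s - c s] is nonincreasing. *)
Lemma gronwall (m dm : R -> R) (l c t : R) : continuous m ->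
  (forall s : R, 0 < s -> is_derive s 1 m (dm s)) -> 0 <= l -> 0 <= c ->
  (forall s, 0 < s -> dm s <= l * m s + c) -> 0 <= t ->
  m t <= expR (l * t) * (m 0 + c * t).
Proof.
move=> cm dmP l0 c0 dm_le; rewrite le_eqVlt => /predU1P[<-|t0].
  by rewrite !mulr0 expR0 mul1r addr0.
pose F s := expR (- l * s) * m s - c * s.
have dexp (s : R) : is_derive s 1 (fun s => expR (- l * s)) (expR (- l * s) * - l).
  have dl : is_derive s 1 (fun s : R => - l * s) (- l).
    by apply: is_derive_eq; rewrite /GRing.scale/=; ring.
  exact: (is_derive1_comp (f := expR)).
have dF (s : R) : 0 < s ->
    is_derive s 1 F (expR (- l * s) * (dm s - l * m s) - c).
  move=> s0; have dms := dmP s s0; have des := dexp s.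
  by apply: is_derive_eq; rewrite /GRing.scale/=; ring.
have cF : continuous F.
  apply: continuous_sub; last by apply: continuous_scale => y; exact: cvg_id.
  apply: continuous_mul => //.
  by apply: is_derive_continuous => s; exact: dexp.
have [||s] := @MVT R F (fun s => expR (- l * s) * (dm s - l * m s) - c) 0 t t0.
- by move=> s; rewrite in_itv/= => /andP[s0 _]; exact: dF.
- exact: continuous_subspaceT.
rewrite in_itv/= => /andP[s0 st] FE.
have : F t - F 0 <= 0.
  rewrite FE pmulr_lle0 ?subr0// subr_le0.
  apply: (@le_trans _ _ (expR (- l * s) * c)).
    by rewrite ler_wpM2l ?expR_ge0//; have := dm_le s s0; lra.
  by rewrite ler_piMl// -expR0 ler_expR mulNr oppr_le0 mulr_ge0// ltW.
rewrite /F !mulr0 expR0 mul1r subr0 subr_le0 lerBlDr mulNr expRN.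
rewrite mulrC ler_pdivrMr ?expR_gt0// => /le_trans; apply.
by rewrite mulrC.
Qed.

(** The nonlinearity multiplies [u] by a real function, and such forcing terms
    cancel in the growth of the mass. *)
Lemma mass_conserved p q t : nls p q -> 0 <= t -> mass p q t = mass p q 0.
Proof.
move=> E; apply: derive0_eq; first exact: continuous_mass.
move=> s s0.
have jW r : jcont r -> jcont (fun t x => pot p q t x * r t x).
  by move=> jr; apply: jcontM => //; exact: jcont_pot.
have := @is_derive_mass p q (fun t x => pot p q t x * q t x)
  (fun t x => pot p q t x * p t x) s (jW _ (jcont_val q)) (jW _ (jcont_val p))
  (fun t x t0 => (E t x t0).1) (fun t x t0 => (E t x t0).2) s0.
rewrite (_ : circ _ = 0)//.
rewrite -[RHS](mul0r (2 * pi)) -circ_cst; apply: eq_circ => x; ring.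
Qed.

(** The difference quotient of [circ (v_x ^ 2)] is rewritten by Green's formula so
    that only a time quotient of [v] itself appears: [v_x] need not be
    differentiable in time. *)
Lemma is_derive_kin1 p (t : R) : 0 < t ->
  is_derive t 1 (kin1 p) (circ (fun x => - (vt p t x * (vxx p t x + vxx p t x)))).
Proof.
move=> t0; apply: is_derive_quotient.
have cp := continuous_val p; have cpxx := continuous_vxx p.
have -> : (fun s => (kin1 p s - kin1 p t) / (s - t)) =
  (fun s => circ (fun x => - ((p s x - p t x) / (s - t) * (vxx p s x + vxx p t x)))).
  apply/funext => s.
  have K r : kin1 p r = - circ (fun x => p r x * vxx p r x).
    exact: circ_by_parts (is_derive_val p r) (is_derive_vx p r) (val_per p r) (vx_per p r).
  have G := circ_green (cpxx s) (cpxx t) (is_derive_val p s) (is_derive_vx p s)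
    (is_derive_val p t) (is_derive_vx p t) (val_per p s) (vx_per p s)
    (val_per p t) (vx_per p t).
  have cm r r' : continuous (fun x => p r x * vxx p r' x) by exact: continuous_mul.
  have -> : circ (fun x => - ((p s x - p t x) / (s - t) * (vxx p s x + vxx p t x)))
    = circ (fun x => - (s - t)^-1 *
      ((p s x * vxx p s x - p t x * vxx p t x) +
       (p s x * vxx p t x - vxx p s x * p t x))).
    by apply: eq_circ => x; ring.
  have cm' : continuous (fun x => vxx p s x * p t x) by exact: continuous_mul.
  rewrite circZ; last by apply: continuous_add; exact: continuous_sub.
  rewrite circD; [|exact: continuous_sub..].
  by rewrite !circB// G subrr addr0 !K; ring.
have [M FM] := quotient_bounded (jcont_vt p) (fun s x => @is_derive_vt p s x) t0.
have [B B0 FB] := jcont_bounded 0 (2 * t) (jcont_vxx p).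
apply: (@circ_cvg _ _ _ _ (M * (B + B))).
- move=> s; apply: continuous_opp; apply: continuous_mul; last exact: continuous_add.
  rewrite (_ : (fun x => _) = (fun x => (s - t)^-1 * (p s x - p t x))).
    by apply: continuous_scale; exact: continuous_sub.
  by apply/funext => x; rewrite mulrC.
- near=> s => x xI; rewrite normrN normrM ler_pM//.
    by move: x xI; near: s.
  have : `|t - s| < t by near: s; apply: nbhs_dnbhs; exact: nbhsx_ballx.
  rewrite ltr_distlC => /andP[s1 s2].
  by rewrite (le_trans (ler_normD _ _))// lerD// FB//; lra.
- move=> x xI; apply: cvgN; apply: cvgM.
    exact: cvg_quotient (is_derive_vt p x t0).
  apply: cvgD; last exact: cvg_cst.
  apply: (@continuous_dnbhs _ (fun s => vxx p s x)).
  exact: (jcont_trace (jcont_vxx p)).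
Unshelve. all: end_near. Qed.

Lemma continuous_kin1 p : continuous (kin1 p).
Proof.
have -> : kin1 p = (fun t => circ (fun x => - (p t x * vxx p t x))).
  apply/funext => t.
  rewrite /kin1 (circ_by_parts _ (is_derive_val p t) (is_derive_vx p t) (val_per p t) (vx_per p t)).
    rewrite -mulN1r -circZ; last first.
      by apply: continuous_mul; [exact: continuous_val|exact: continuous_vxx].
    by apply: eq_circ => x; rewrite mulN1r.
  exact: continuous_vxx.
apply: (@circ_continuous _ (fun t x => - (p t x * vxx p t x))).
by apply: jcontN; apply: jcontM; [exact: jcont_val|exact: jcont_vxx].
Qed.

(** Replacing [vxx] by the equation in the derivative of the kinetic energy leaves
    [- 4 cos(2x) rho (p p_t + q q_t)], which is minus the time derivative of
    [cos(2x) rho^2]. *)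
Lemma energy_conserved p q t : nls p q -> 0 <= t ->
  kin p q t + quartic p q t = kin p q 0 + quartic p q 0.
Proof.
move=> E; apply: (@derive0_eq (fun t => kin p q t + quartic p q t)).
  apply: continuous_add; first by apply: continuous_add; exact: continuous_kin1.
  exact/circ_continuous/jcont_quartic.
move=> s s0.
have dp := is_derive_kin1 p s0; have dq := is_derive_kin1 q s0.
pose D t x := cos (2 * x) * (4 * rho p q t x * (p t x * vt p t x + q t x * vt q t x)).
have jD : jcont D.
  apply: jcontM; first exact/jcont_space/continuous_cos2.
  apply: jcontM; first by apply: jcontZ; exact: jcont_rho.
  by apply: jcontD; apply: jcontM; first [exact: jcont_val|exact: jcont_vt].
have dQ : is_derive s 1 (quartic p q) (circ (D s)).
  apply: is_derive_circ => //; first exact: jcont_quartic.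
  move=> r x r0; have dpr := is_derive_vt p x r0; have dqr := is_derive_vt q x r0.
  by rewrite /rho; apply: is_derive_eq; rewrite /GRing.scale/= /D /rho; ring.
apply: is_derive_eq.
have cp := continuous_val p s; have cq := continuous_val q s.
have cpxx := continuous_vxx p s; have cqxx := continuous_vxx q s.
have cpt := continuous_vt p s; have cqt := continuous_vt q s.
have ck (f g : R -> R) : continuous f -> continuous g ->
    continuous (fun x => - (f x * (g x + g x))).
  by move=> cf cg; apply: continuous_opp; apply: continuous_mul => //; exact: continuous_add.
rewrite -circD; [|exact: ck..].
rewrite -circD; [|apply: continuous_add; exact: ck|exact: jcont_slice].
rewrite -[RHS](mul0r (2 * pi)) -circ_cst; apply: eq_circ => x.
rewrite /D; have [-> ->] := E s x s0; rewrite /pot; ring.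
Qed.

End waves.

Arguments continuous_val {R} p t x.
Arguments continuous_vx {R} p t x.
Arguments continuous_vxx {R} p t x.
Arguments continuous_vt {R} p t x.
Arguments jcont_val {R} w x.
Arguments jcont_vxx {R} w x.
Arguments jcont_vt {R} w x.
Arguments jcont_rho {R} p q x.
Arguments continuous_rho {R} p q t x.
Arguments continuous_mass {R} p q x.
Arguments jcont_pot {R} p q x.

(** * A priori bound, stability and comparison with the free flow *)

Section bounds.
Context {R : realType}.
Implicit Types (p q : wave (R := R)).

Lemma rho_agmon p q (m t x : R) : 0 < m -> 0 <= x <= 2 * pi ->
  rho p q t x <= (1 + m) * mass p q t + kin p q t / m.
Proof.
move=> m0 xI.
have Ap := agmon (continuous_vx p t) (is_derive_val p t) m0 xI.
have Aq := agmon (continuous_vx q t) (is_derive_val q t) m0 xI.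
rewrite /kin /mass /rho circD; [|exact/continuous_sqr/continuous_val..].
rewrite /kin1 mulrDl mulrDr; lra.
Qed.

Lemma quartic_le p q (t S : R) : (forall x, 0 <= x <= 2 * pi -> rho p q t x <= S) ->
  `|quartic p q t| <= S * mass p q t.
Proof.
move=> rS.
have cr := continuous_rho p q t.
have cQ : continuous (fun x : R => cos (2 * x) * rho p q t x ^+ 2).
  by apply: continuous_mul; [exact: continuous_cos2|exact: continuous_sqr].
rewrite /mass -circZ// ler_norml -mulN1r -circZ; last exact: continuous_scale.
have r2 x : 0 <= x <= 2 * pi -> rho p q t x ^+ 2 <= S * rho p q t x.
  by move=> xI; rewrite expr2 ler_wpM2r ?rho_ge0// rS.
apply/andP; split; apply: le_circ => //.
- by apply: continuous_scale; exact: continuous_scale.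
- move=> x xI; rewrite mulN1r lerNl -mulNr.
  apply: le_trans (r2 x xI).
  by rewrite ler_piMl ?sqr_ge0// lerNl cos_geN1.
- exact: continuous_scale.
- move=> x xI; apply: le_trans (r2 x xI).
  by rewrite ler_piMl ?sqr_ge0// cos_le1.
Qed.

(** At a maximum point of [rho], Agmon's inequality with [m = 1 + 2 M] lets the
    quartic term of the energy be absorbed. *)
Lemma apriori p q (M H t : R) : nls p q -> mass p q 0 <= M ->
  kin p q 0 + quartic p q 0 <= H -> 0 <= H -> 0 <= t ->
  let S := 4 * M * (1 + M) + 2 * H in
  (forall x, 0 <= x <= 2 * pi -> rho p q t x <= S) /\ kin p q t <= H + S * M.
Proof.
move=> E M0 HE H0 t0 S.
have Mt : mass p q t <= M by rewrite mass_conserved.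
have m0 : 0 <= mass p q t by exact: mass_ge0.
have [y] := EVT_max (ltW twopi_gt0)
  (continuous_subspaceT (continuous_rho p q t) : {within `[0, 2 * pi], continuous (rho p q t)}).
rewrite in_itv/= => yI ymax.
have {}ymax x : 0 <= x <= 2 * pi -> rho p q t x <= rho p q t y.
  by move=> xI; apply: ymax; rewrite in_itv.
have := quartic_le ymax.
rewrite ler_norml => /andP[Q1 _].
have Ec := energy_conserved E t0.
have r0 := rho_ge0 p q t y.
have kt : kin p q t <= H + rho p q t y * M.
  have : rho p q t y * mass p q t <= rho p q t y * M by rewrite ler_wpM2l.
  lra.
have mu0 : 0 < 1 + 2 * M by lra.
have := rho_agmon p q t mu0 yI.
have : kin p q t / (1 + 2 * M) <= H + rho p q t y / 2.
  rewrite ler_pdivrMr//; nra.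
have : (1 + (1 + 2 * M)) * mass p q t <= (2 + 2 * M) * M by nra.
move=> h1 h2 h3.
have yS : rho p q t y <= S by rewrite /S; lra.
split; first by move=> x xI; exact: le_trans (ymax x xI) yS.
have : rho p q t y * M <= S * M by rewrite ler_wpM2r//; lra.
lra.
Qed.

Lemma kin1_sub p q (t : R) : kin1 (wave_sub p q) t <= 2 * kin1 p t + 2 * kin1 q t.
Proof.
have cp := continuous_vx p t; have cq := continuous_vx q t.
rewrite /kin1 -!circZ; [|exact: continuous_sqr..].
rewrite -circD; [|exact/continuous_scale/continuous_sqr..].
apply: le_circ.
- by apply: continuous_sqr; exact: continuous_sub.
- by apply: continuous_add; exact/continuous_scale/continuous_sqr.
- move=> x _ /=; have := sqr_ge0 (vx p t x + vx q t x); nra.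
Qed.

Lemma kin_sub p1 q1 p2 q2 (t K : R) : kin p1 q1 t <= K -> kin p2 q2 t <= K ->
  kin (wave_sub p1 p2) (wave_sub q1 q2) t <= 4 * K.
Proof.
rewrite /kin => K1 K2; have := kin1_sub p1 p2 t; have := kin1_sub q1 q2 t; lra.
Qed.

(** Mass growth rate of the difference of two solutions. The part
    [rho1 ((p1 - p2) (q1 - q2) - (q1 - q2) (p1 - p2))] vanishes; what is left is the
    product of [rho1 - rho2] and of [(p1 - p2) q2 - (q1 - q2) p2], each of which is
    of first order in the difference. *)
Lemma cubic_lipschitz (c S p1 q1 p2 q2 : R) : -1 <= c <= 1 ->
  p1 ^+ 2 + q1 ^+ 2 <= S -> p2 ^+ 2 + q2 ^+ 2 <= S ->
  2 * ((p1 - p2) * (2 * c * (p1 ^+ 2 + q1 ^+ 2) * q1 - 2 * c * (p2 ^+ 2 + q2 ^+ 2) * q2)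
     - (q1 - q2) * (2 * c * (p1 ^+ 2 + q1 ^+ 2) * p1 - 2 * c * (p2 ^+ 2 + q2 ^+ 2) * p2))
  <= 10 * S * ((p1 - p2) ^+ 2 + (q1 - q2) ^+ 2).
Proof.
move=> /andP[c1 c2] r1 r2.
set P := p1 - p2; set Q := q1 - q2.
set A := p1 ^+ 2 + q1 ^+ 2 - (p2 ^+ 2 + q2 ^+ 2).
set B := P * q2 - Q * p2.
have -> : 2 * (P * (2 * c * (p1 ^+ 2 + q1 ^+ 2) * q1 - 2 * c * (p2 ^+ 2 + q2 ^+ 2) * q2)
     - Q * (2 * c * (p1 ^+ 2 + q1 ^+ 2) * p1 - 2 * c * (p2 ^+ 2 + q2 ^+ 2) * p2))
  = c * (4 * (A * B)) by rewrite /A /B /P /Q; ring.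
have D0 : 0 <= P ^+ 2 + Q ^+ 2 by rewrite addr_ge0 ?sqr_ge0.
have A2 : A ^+ 2 <= 4 * S * (P ^+ 2 + Q ^+ 2).
  have -> : A = P * (p1 + p2) + Q * (q1 + q2) by rewrite /A /P /Q; ring.
  have CS : (P * (p1 + p2) + Q * (q1 + q2)) ^+ 2 <=
      (P ^+ 2 + Q ^+ 2) * ((p1 + p2) ^+ 2 + (q1 + q2) ^+ 2).
    have := sqr_ge0 (P * (q1 + q2) - Q * (p1 + p2)); nra.
  apply: (le_trans CS); rewrite mulrC ler_wpM2r//.
  have := sqr_ge0 (p1 - p2); have := sqr_ge0 (q1 - q2); nra.
have B2 : B ^+ 2 <= S * (P ^+ 2 + Q ^+ 2).
  apply: (@le_trans _ _ ((p2 ^+ 2 + q2 ^+ 2) * (P ^+ 2 + Q ^+ 2))).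
    by rewrite /B; have := sqr_ge0 (P * p2 + Q * q2); nra.
  by rewrite ler_wpM2r.
have E1 := sqr_ge0 (A - B); have E2 := sqr_ge0 (A + B).
have AB : `|4 * (A * B)| <= 10 * S * (P ^+ 2 + Q ^+ 2).
  by rewrite ler_norml; apply/andP; split; nra.
apply: le_trans AB; apply: (le_trans (ler_norm _)).
by rewrite normrM ler_piMl// ler_norml c1.
Qed.

Lemma jcont_pot_val p q (w : wave (R := R)) : jcont (fun t x => pot p q t x * w t x).
Proof. by apply: jcontM; [exact: jcont_pot|exact: jcont_val]. Qed.

Lemma mass_sub_growth p1 q1 p2 q2 (S t : R) : nls p1 q1 -> nls p2 q2 -> 0 <= S ->
  (forall t x, 0 <= t -> 0 <= x <= 2 * pi -> rho p1 q1 t x <= S) ->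
  (forall t x, 0 <= t -> 0 <= x <= 2 * pi -> rho p2 q2 t x <= S) -> 0 <= t ->
  mass (wave_sub p1 p2) (wave_sub q1 q2) t <=
  expR (10 * S * t) * mass (wave_sub p1 p2) (wave_sub q1 q2) 0.
Proof.
move=> E1 E2 S0 r1 r2 t0.
set P := wave_sub p1 p2; set Q := wave_sub q1 q2.
pose a t x := pot p1 q1 t x * q1 t x - pot p2 q2 t x * q2 t x.
pose b t x := pot p1 q1 t x * p1 t x - pot p2 q2 t x * p2 t x.
have ja : jcont a by apply: jcontB; exact: jcont_pot_val.
have jb : jcont b by apply: jcontB; exact: jcont_pot_val.
have dm (s : R) : 0 < s -> is_derive s 1 (mass P Q)
    (circ (fun x => 2 * (P s x * a s x - Q s x * b s x))).
  move=> s0; apply: is_derive_mass => // r x r0 /=.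
    by have [-> _] := E1 r x r0; have [-> _] := E2 r x r0; rewrite /a; ring.
  by have [_ ->] := E1 r x r0; have [_ ->] := E2 r x r0; rewrite /b; ring.
have S10 : 0 <= 10 * S by rewrite mulr_ge0.
rewrite (_ : mass P Q 0 = mass P Q 0 + 0 * t); last by rewrite mul0r addr0.
apply: (gronwall (continuous_mass P Q) dm) => // s s0.
rewrite addr0 /mass -circZ; last exact: continuous_rho.
apply: le_circ.
- apply: continuous_scale; apply: continuous_sub; apply: continuous_mul;
    by [exact: continuous_val|exact: jcont_slice].
- by apply: continuous_scale; exact: continuous_rho.
- move=> x xI; apply: cubic_lipschitz.
  + by rewrite cos_geN1 cos_le1.
  + exact: r1 (ltW s0) xI.
  + exact: r2 (ltW s0) xI.
Qed.

(** The mass distance grows at most exponentially, and the bound on the kinetic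
    energy upgrades the mean square to the sup norm. *)
Lemma nls_stability p1 q1 p2 q2 (S K m t x : R) : nls p1 q1 -> nls p2 q2 -> 0 <= S ->
  (forall t x, 0 <= t -> 0 <= x <= 2 * pi -> rho p1 q1 t x <= S) ->
  (forall t x, 0 <= t -> 0 <= x <= 2 * pi -> rho p2 q2 t x <= S) ->
  kin p1 q1 t <= K -> kin p2 q2 t <= K -> 0 < m -> 0 <= t -> 0 <= x <= 2 * pi ->
  rho (wave_sub p1 p2) (wave_sub q1 q2) t x <=
  (1 + m) * (expR (10 * S * t) * mass (wave_sub p1 p2) (wave_sub q1 q2) 0) + 4 * K / m.
Proof.
move=> E1 E2 S0 r1 r2 k1 k2 m0 t0 xI.
apply: le_trans (rho_agmon _ _ _ m0 xI) _; apply: lerD.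
  by rewrite ler_wpM2l ?addr_ge0 ?(ltW m0)//; exact: (mass_sub_growth E1 E2 S0 r1 r2 t0).
by rewrite ler_wpM2r ?invr_ge0 ?(ltW m0)//; exact: kin_sub.
Qed.

(** The difference with the free flow vanishes at time 0 and is forced by the
    nonlinearity, whose square is at most [4 S^3]. The weight [l] in Young's
    inequality becomes the rate in Gronwall's; it is to be taken of the order of the
    squared size of the data, so that [l t] stays bounded. *)
Lemma nls_near_free p q pf qf (S K l m t x : R) : nls p q -> free pf qf -> 0 <= S ->
  (forall t x, 0 <= t -> 0 <= x <= 2 * pi -> rho p q t x <= S) ->
  (forall x, p 0 x = pf 0 x) -> (forall x, q 0 x = qf 0 x) ->
  kin p q t <= K -> kin pf qf t <= K -> 0 < l -> 0 < m -> 0 <= t ->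
  0 <= x <= 2 * pi ->
  rho (wave_sub p pf) (wave_sub q qf) t x <=
  (1 + m) * (expR (l * t) * (4 * S ^+ 3 / l * (2 * pi) * t)) + 4 * K / m.
Proof.
move=> E F S0 rS p0 q0 kp kf l0 m0 t0 xI.
set P := wave_sub p pf; set Q := wave_sub q qf.
apply: le_trans (rho_agmon _ _ _ m0 xI) _; apply: lerD; last first.
  by rewrite ler_wpM2r ?invr_ge0 ?(ltW m0)//; exact: kin_sub.
rewrite ler_wpM2l ?addr_ge0 ?(ltW m0)//.
pose a t x := pot p q t x * q t x; pose b t x := pot p q t x * p t x.
have ja : jcont a by exact: jcont_pot_val.
have jb : jcont b by exact: jcont_pot_val.
have dm (s : R) : 0 < s -> is_derive s 1 (mass P Q)
    (circ (fun x => 2 * (P s x * a s x - Q s x * b s x))).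
  move=> s0; apply: is_derive_mass => // r y r0 /=.
    by have [-> _] := E r y r0; have [-> _] := F r y r0; rewrite /a; ring.
  by have [_ ->] := E r y r0; have [_ ->] := F r y r0; rewrite /b; ring.
have -> : 4 * S ^+ 3 / l * (2 * pi) * t =
    mass P Q 0 + 4 * S ^+ 3 / l * (2 * pi) * t.
  rewrite [mass P Q 0](_ : _ = 0) ?add0r//.
  rewrite -[RHS](mul0r (2 * pi)) -circ_cst; apply: eq_circ => y.
  by rewrite /rho /= p0 q0 !subrr expr0n addr0.
have c0 : 0 <= 4 * S ^+ 3 / l.
  by rewrite divr_ge0 ?(ltW l0)// mulr_ge0// exprn_ge0.
apply: (gronwall (continuous_mass P Q) dm) => //.
- exact: ltW.
- by rewrite mulr_ge0// ltW// twopi_gt0.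
move=> s s0.
rewrite /mass -circZ; last exact: continuous_rho.
rewrite -circ_cst -circD; [|exact/continuous_scale/continuous_rho|exact: cst_continuous].
apply: le_circ.
- apply: continuous_scale; apply: continuous_sub; apply: continuous_mul;
    by [exact: continuous_val|exact: jcont_slice].
- by apply: continuous_add; [exact/continuous_scale/continuous_rho|exact: cst_continuous].
- move=> y yI; have r := rS s y (ltW s0) yI.
  have ab : a s y ^+ 2 + b s y ^+ 2 <= 4 * S ^+ 3.
    have -> : a s y ^+ 2 + b s y ^+ 2 = 4 * (cos (2 * y) ^+ 2 * rho p q s y ^+ 3).
      by rewrite /a /b /pot /rho; ring.
    rewrite ler_wpM2l//; apply: (@le_trans _ _ (rho p q s y ^+ 3)).
      by rewrite ler_piMl ?exprn_ge0 ?rho_ge0//.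
    by rewrite lerXn2r ?nnegrE ?rho_ge0.
  have li : 0 < l^-1 by rewrite invr_gt0.
  have lli : l * l^-1 = 1 by rewrite divff ?gt_eqF.
  rewrite /rho; move: (P s y) (Q s y) (a s y) (b s y) ab => X Y A B ab.
  apply: (@le_trans _ _ (l * (X ^+ 2 + Y ^+ 2) + (A ^+ 2 + B ^+ 2) / l)); last first.
    by rewrite lerD2l ler_wpM2r// ltW.
  have E1 := mulr_ge0 (ltW li) (sqr_ge0 (l * X - A)).
  have E2 := mulr_ge0 (ltW li) (sqr_ge0 (l * Y + B)).
  have E1' : l^-1 * (l * X - A) ^+ 2 = (l * l^-1) * (l * X ^+ 2) + A ^+ 2 / l - (l * l^-1) * (2 * X * A).
    by ring.
  have E2' : l^-1 * (l * Y + B) ^+ 2 = (l * l^-1) * (l * Y ^+ 2) + B ^+ 2 / l + (l * l^-1) * (2 * Y * B).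
    by ring.
  move: E1 E2; rewrite E1' E2' lli; lra.
Qed.
End bounds.

(** * From complex solutions to pairs of real waves *)

Section bridge.
Context {R : realType}.

(** The clamping map [(t, x) |-> (max t 0, x)] is continuous with values in the
    closed half-plane. *)
Lemma jcont_clamp (F : R -> R -> R) :
  {within [set p : R * R | 0 <= p.1], continuous (fun p => F p.1 p.2)} ->
  jcont (fun t x => F (Num.max t 0) x).
Proof.
move=> /subspace_continuousP cF [t x].
pose c (p : R * R) : R * R := (Num.max p.1 0, p.2).
have c_ge0 p : [set p : R * R | 0 <= p.1] (c p) by rewrite /= le_max lexx orbT.
have cmax1 : continuous (fun s : R => Num.max s 0).
  rewrite (_ : (fun _ => _) = (fun s => 2^-1 * (s + `|s|))); last first.
    apply/funext => s; have [s0|s0] := leP 0 s.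
      by rewrite ger0_norm//; lra.
    by rewrite ltr0_norm//; lra.
  apply: continuous_scale; apply: continuous_add => y; first exact: cvg_id.
  exact: norm_continuous.
have cc : c p @[p --> (t, x)] --> c (t, x).
  have cfst := @cvg_fst _ _ _ _ (nbhs_filter x)
    : (@fst R R @ filter_prod (nbhs t) (nbhs x) --> t).
  have csnd := @cvg_snd _ _ _ _ (nbhs_filter t)
    : (@snd R R @ filter_prod (nbhs t) (nbhs x) --> x).
  exact: (cvg_pair (cvg_comp _ _ cfst (cmax1 t)) csnd).
move=> A /(cF _ (c_ge0 (t, x))) /= FA.
have cFA : \forall p \near (t, x), [set p : R * R | 0 <= p.1] (c p) ->
  A (F (c p).1 (c p).2) := cc _ FA.
by apply: (@filterS _ (nbhs (t, x)) _ _ _ _ cFA) => p; apply; exact: c_ge0.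
Qed.

(** The time derivatives of the two waves are defined by the equation, since the
    solution is differentiable in time only for [t > 0] while a jointly continuous
    extension is needed. *)
Lemma nls_solution_waves (u0 : R -> R[i]) (u : R -> R -> R[i]) :
  nls_solution u0 u -> exists p q : wave (R := R), [/\ nls p q,
    forall t x, 0 <= t -> p t x = complex.Re (u t x) &
    forall t x, 0 <= t -> q t x = complex.Im (u t x)].
Proof.
move=> [_ uper udx [[cRe cIm] [cRexx cImxx]] ueq].
pose c (t : R) := Num.max t 0.
have c0 t : 0 <= c t by rewrite le_max lexx orbT.
have cE t : 0 <= t -> c t = t.
  by move=> t0; rewrite /c; have [//|] := leP 0 t; rewrite ltNge t0.
pose p t x := complex.Re (u (c t) x); pose q t x := complex.Im (u (c t) x).
pose px t x := complex.Re (dx u (c t) x); pose qx t x := complex.Im (dx u (c t) x).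
pose pxx t x := complex.Re (dxx u (c t) x); pose qxx t x := complex.Im (dxx u (c t) x).
pose W t x := 2 * cos (2 * x) * (p t x ^+ 2 + q t x ^+ 2).
pose pt t x := - qxx t x + W t x * q t x; pose qt t x := pxx t x - W t x * p t x.
have jp : jcont p by exact: (@jcont_clamp (fun t x => complex.Re (u t x)) cRe).
have jq : jcont q by exact: (@jcont_clamp (fun t x => complex.Im (u t x)) cIm).
have jpxx : jcont pxx by exact: (@jcont_clamp (fun t x => complex.Re (dxx u t x)) cRexx).
have jqxx : jcont qxx by exact: (@jcont_clamp (fun t x => complex.Im (dxx u t x)) cImxx).
have jW : jcont W.
  apply: (@jcontM _ (fun _ x => 2 * cos (2 * x)) (fun t x => p t x ^+ 2 + q t x ^+ 2)).
    apply: (@jcont_space _ (fun x => 2 * cos (2 * x))).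
    by apply: continuous_scale; exact: continuous_cos2.
  by apply: jcontD; exact: jcontX.
have jpt : jcont pt by apply: jcontD; [exact: jcontN|exact: jcontM].
have jqt : jcont qt by apply: jcontB => //; exact: jcontM.
have dp (t x : R) : is_derive x 1 (p t) (px t x).
  have [[h _] _] := udx (c t) x (c0 t).
  by rewrite /px /= derive1E; exact: derivableP.
have dq (t x : R) : is_derive x 1 (q t) (qx t x).
  have [[_ h] _] := udx (c t) x (c0 t).
  by rewrite /qx /= derive1E; exact: derivableP.
have dpx (t x : R) : is_derive x 1 (px t) (pxx t x).
  have [_ [h _]] := udx (c t) x (c0 t).
  by rewrite /pxx /= derive1E; exact: derivableP.
have dqx (t x : R) : is_derive x 1 (qx t) (qxx t x).
  have [_ [_ h]] := udx (c t) x (c0 t).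
  by rewrite /qxx /= derive1E; exact: derivableP.
have near_c (t : R) : 0 < t -> \forall s \near t, s = c s.
  move=> t0; near=> s; rewrite cE//; near: s.
  by apply: filterS (lt_nbhsr t0) => s /ltW.
have ueq' (t x : R) : 0 < t -> complex.Re (dt u t x) = pt t x /\ complex.Im (dt u t x) = qt t x.
  move=> t0; have [_] := ueq t x t0.
  rewrite /pt /qt /W /p /q /pxx /qxx cE ?(ltW t0)//.
  case: (dt u t x) => a b; case: (dxx u t x) => e f; case: (u t x) => g h.
  rewrite /= sqr_sqrtr ?addr_ge0 ?sqr_ge0//.
  by simpc => -[/= E1 E2]; split; lra.
have dpt (t x : R) : 0 < t -> is_derive t 1 (p ^~ x) (pt t x).
  move=> t0; have [[h _] _] := ueq t x t0.
  have [<- _] := ueq' t x t0; rewrite /dt /cderive1 /= derive1E.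
  apply: (@near_eq_is_derive _ _ _ (fun s => complex.Re (u s x))); last exact: derivableP.
  by apply: filterS (near_c t t0) => s; rewrite /p => <-.
have dqt (t x : R) : 0 < t -> is_derive t 1 (q ^~ x) (qt t x).
  move=> t0; have [[_ h] _] := ueq t x t0.
  have [_ <-] := ueq' t x t0; rewrite /dt /cderive1 /= derive1E.
  apply: (@near_eq_is_derive _ _ _ (fun s => complex.Im (u s x))); last exact: derivableP.
  by apply: filterS (near_c t t0) => s; rewrite /q => <-.
have perE (f : R -> R) : (forall x, f (x + 2 * pi) = f x) ->
    forall x : R, derive1 f (x + 2 * pi) = derive1 f x.
  by move=> fper x; rewrite /derive1; under eq_fun do rewrite addrA !fper.
have per (f : R -> R) : (forall x, f (x + 2 * pi) = f x) -> f (2 * pi) = f 0.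
  by move=> fper; rewrite -[2 * pi]add0r fper.
have pper t x : p t (x + 2 * pi) = p t x by rewrite /p uper.
have qper t x : q t (x + 2 * pi) = q t x by rewrite /q uper.
pose P := Wave jp jpxx jpt dp dpx dpt (fun t => per _ (pper t))
  (fun t => per _ (perE _ (pper t))).
pose Q := Wave jq jqxx jqt dq dqx dqt (fun t => per _ (qper t))
  (fun t => per _ (perE _ (qper t))).
exists P, Q; split.
- by move=> t x t0.
- by move=> t x t0; rewrite /= /p cE.
- by move=> t x t0; rewrite /= /q cE.
Unshelve. all: end_near. Qed.

Lemma jcont_time (f : R -> R) : continuous f -> jcont (fun t x => f t).
Proof.
move=> cf [t x]; have cfst := @cvg_fst _ _ _ _ (nbhs_filter x)
  : (@fst R R @ filter_prod (nbhs t) (nbhs x) --> t).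
exact: (cvg_comp _ _ cfst (cf t)).
Qed.

Lemma continuous_trig (a b : R) : continuous (fun x => a * cos x + b * sin x).
Proof.
by apply: continuous_add; apply: continuous_scale;
  [exact: continuous_cos|exact: continuous_sin].
Qed.

(** The real and imaginary parts of the free evolution of data supported on the
    frequencies 1 and -1 have this form. *)
Program Definition trig_wave (a b c d : R) : wave (R := R) :=
  @Wave _
   (fun t x => cos t * (a * cos x + b * sin x) + sin t * (c * cos x + d * sin x))
   (fun t x => cos t * (- a * sin x + b * cos x) + sin t * (- c * sin x + d * cos x))
   (fun t x => - (cos t * (a * cos x + b * sin x) + sin t * (c * cos x + d * sin x)))
   (fun t x => - sin t * (a * cos x + b * sin x) + cos t * (c * cos x + d * sin x))
   _ _ _ _ _ _ _ _.
Next Obligation.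
move=> a b c d; apply: jcontD; apply: jcontM.
- exact: (@jcont_time cos (@continuous_cos R)).
- apply: (@jcont_space _ (fun x => a * cos x + b * sin x)).
  exact: continuous_trig.
- exact: (@jcont_time sin (@continuous_sin R)).
- apply: (@jcont_space _ (fun x => c * cos x + d * sin x)).
  exact: continuous_trig.
Qed.
Next Obligation.
move=> a b c d; apply: jcontN; apply: jcontD; apply: jcontM.
- exact: (@jcont_time cos (@continuous_cos R)).
- apply: (@jcont_space _ (fun x => a * cos x + b * sin x)).
  exact: continuous_trig.
- exact: (@jcont_time sin (@continuous_sin R)).
- apply: (@jcont_space _ (fun x => c * cos x + d * sin x)).
  exact: continuous_trig.
Qed.
Next Obligation.
move=> a b c d; apply: jcontD; apply: jcontM.
- by apply: (@jcont_time (fun t => - sin t)); apply: continuous_opp; exact: continuous_sin.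
- apply: (@jcont_space _ (fun x => a * cos x + b * sin x)).
  exact: continuous_trig.
- exact: (@jcont_time cos (@continuous_cos R)).
- apply: (@jcont_space _ (fun x => c * cos x + d * sin x)).
  exact: continuous_trig.
Qed.
Next Obligation.
by move=> a b c d t x; apply: is_derive_eq; rewrite /GRing.scale/=; ring.
Qed.
Next Obligation.
by move=> a b c d t x; apply: is_derive_eq; rewrite /GRing.scale/=; ring.
Qed.
Next Obligation.
by move=> a b c d t x _; apply: is_derive_eq; rewrite /GRing.scale/=; ring.
Qed.
Next Obligation.
by move=> a b c d t; rewrite /= !mulr_natl cos2pi sin2pi cos0 sin0.
Qed.
Next Obligation.
by move=> a b c d t; rewrite /= !mulr_natl cos2pi sin2pi cos0 sin0.
Qed.

Lemma free_trig_wave (a b c d : R) :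
  free (trig_wave a b c d) (trig_wave c d (- a) (- b)).
Proof. by move=> t x _ /=; split; ring. Qed.

(** Measures the data with real part [a cos + b sin] and imaginary part
    [c cos + d sin]; the wave [trig_wave c d (- a) (- b)] is the imaginary part of the
    free evolution whose real part is [trig_wave a b c d]. *)
Definition size4 (a b c d : R) : R := a ^+ 2 + b ^+ 2 + c ^+ 2 + d ^+ 2.

Lemma size4_ge0 (a b c d : R) : 0 <= size4 a b c d.
Proof. by rewrite /size4 !addr_ge0 ?sqr_ge0. Qed.

Lemma trig_sqr_le (a b x : R) : (a * cos x + b * sin x) ^+ 2 <= a ^+ 2 + b ^+ 2.
Proof.
have := cos2Dsin2 x; have := sqr_ge0 (a * sin x - b * cos x).
move: (cos x) (sin x) => c s h e.
have -> : a ^+ 2 + b ^+ 2 = (a ^+ 2 + b ^+ 2) * (c ^+ 2 + s ^+ 2) by rewrite e mulr1.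
nra.
Qed.

(** The length of the circle is less than 8. *)
Lemma circ_le_cst (f : R -> R) (N : R) : continuous f -> (forall x, f x <= N) -> 0 <= N ->
  circ f <= 8 * N.
Proof.
move=> cf fN N0; apply: (@le_trans _ _ (circ (fun=> N))).
  by apply: le_circ => //; exact: cst_continuous.
by rewrite circ_cst mulrC ler_wpM2r//; have := pihalf_lt2 R; lra.
Qed.

(** The free evolution multiplies such data by [exp(- i t)], which preserves the
    modulus. *)
Lemma rho_trig (a b c d t x : R) :
  rho (trig_wave a b c d) (trig_wave c d (- a) (- b)) t x =
  (a * cos x + b * sin x) ^+ 2 + (c * cos x + d * sin x) ^+ 2.
Proof.
have e := cos2Dsin2 t; rewrite /rho /=.
set A := a * cos x + b * sin x; set B := c * cos x + d * sin x.
have -> : - a * cos x + - b * sin x = - A by rewrite /A; ring.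
transitivity ((cos t ^+ 2 + sin t ^+ 2) * (A ^+ 2 + B ^+ 2)); first by ring.
by rewrite e mul1r.
Qed.

Lemma rho_trig_le (a b c d t x : R) :
  rho (trig_wave a b c d) (trig_wave c d (- a) (- b)) t x <= size4 a b c d.
Proof.
rewrite rho_trig /size4 -addrA; apply: lerD; exact: trig_sqr_le.
Qed.

Lemma mass_trig_le (a b c d t : R) :
  mass (trig_wave a b c d) (trig_wave c d (- a) (- b)) t <= 8 * size4 a b c d.
Proof.
apply: circ_le_cst; [exact: continuous_rho|by move=> x; exact: rho_trig_le|].
exact: size4_ge0.
Qed.

(** The space derivative is again a free wave, with permuted coefficients. *)
Lemma kin_trig_le (a b c d t : R) :
  kin (trig_wave a b c d) (trig_wave c d (- a) (- b)) t <= 8 * size4 a b c d.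
Proof.
rewrite /kin /kin1 -circD; [|exact/continuous_sqr/continuous_vx..].
apply: circ_le_cst; [|move=> x /=|exact: size4_ge0].
  by apply: continuous_add; exact/continuous_sqr/continuous_vx.
rewrite [leLHS](_ : _ =
    rho (trig_wave b (- a) d (- c)) (trig_wave d (- c) (- b) (- - a)) t x).
  by apply: (le_trans (rho_trig_le _ _ _ _ _ _)); rewrite /size4 !sqrrN; lra.
by rewrite /rho /=; ring.
Qed.
End bridge.

(** * Sup-norm consequences *)

Section consequences.
Context {R : realType}.
Implicit Types (u v : R -> R -> R[i]).

(** The bounds of the a priori estimate for data of size [L], whose mass and kinetic
    energy are at most [8 L] and whose quartic energy is at most [8 L^2]. *)
Definition rho_bound (L : R) : R := 4 * (8 * L) * (1 + 8 * L) + 2 * (8 * (L + L ^+ 2)).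
Definition kin_bound (L : R) : R := 8 * (L + L ^+ 2) + rho_bound L * (8 * L).

Definition trig_datum (u0 : R -> R[i]) (a b c d : R) : Prop := forall x : R,
  complex.Re (u0 x) = a * cos x + b * sin x /\
  complex.Im (u0 x) = c * cos x + d * sin x.

(** The kinetic energy at time 0 is that of the free wave with the same data, since
    the two waves have the same space derivative there. *)
Lemma nls_solution_bounds (u0 : R -> R[i]) u (a b c d L : R) : nls_solution u0 u ->
  trig_datum u0 a b c d -> size4 a b c d <= L ->
  exists p q : wave (R := R), [/\ nls p q,
    forall t x, 0 <= t -> p t x = complex.Re (u t x) /\ q t x = complex.Im (u t x),
    forall x, p 0 x = a * cos x + b * sin x /\ q 0 x = c * cos x + d * sin x,
    forall t x, 0 <= t -> 0 <= x <= 2 * pi -> rho p q t x <= rho_bound L &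
    forall t, 0 <= t -> kin p q t <= kin_bound L].
Proof.
move=> sol u0E NL; have [p [q [E pE qE]]] := nls_solution_waves sol.
have L0 : 0 <= L := le_trans (size4_ge0 a b c d) NL.
have init x : p 0 x = a * cos x + b * sin x /\ q 0 x = c * cos x + d * sin x.
  have [u00 _ _ _ _] := sol.
  by rewrite pE// qE// u00; exact: u0E.
set pf := trig_wave a b c d; set qf := trig_wave c d (- a) (- b).
have p0 : p 0 = pf 0.
  by apply/funext => x; rewrite (init x).1 /= cos0 sin0; ring.
have q0 : q 0 = qf 0.
  by apply/funext => x; rewrite (init x).2 /= cos0 sin0; ring.
have uniq_vx (v w : wave (R := R)) : v 0 = w 0 -> vx v 0 = vx w 0.
  move=> vw; apply/funext => x.
  have [_ <-] := is_derive_val v 0 x; have [_ <-] := is_derive_val w 0 x.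
  by rewrite vw.
have rho0 : rho p q 0 = rho pf qf 0 by apply/funext => x; rewrite /rho p0 q0.
have mass0 : mass p q 0 <= 8 * L.
  rewrite /mass rho0; apply: le_trans (mass_trig_le _ _ _ _ _) _.
  by rewrite ler_wpM2l.
have kin0 : kin p q 0 <= 8 * L.
  rewrite /kin /kin1 (uniq_vx _ _ p0) (uniq_vx _ _ q0).
  apply: le_trans (kin_trig_le a b c d 0) _.
  by rewrite ler_wpM2l.
have quart0 : quartic p q 0 <= 8 * L ^+ 2.
  have rL x : 0 <= x <= 2 * pi -> rho p q 0 x <= L.
    by move=> _; rewrite rho0; exact: le_trans (rho_trig_le _ _ _ _ _ _) NL.
  have := quartic_le rL; rewrite ler_norml => /andP[_ h]; apply: (le_trans h).
  have : L * mass p q 0 <= L * (8 * L) by rewrite ler_wpM2l.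
  by move=> /le_trans; apply; rewrite expr2; lra.
have H0 : 0 <= 8 * (L + L ^+ 2) by rewrite mulr_ge0// addr_ge0// sqr_ge0.
have HE : kin p q 0 + quartic p q 0 <= 8 * (L + L ^+ 2) by lra.
have AP t t0 := apriori E mass0 HE H0 (t := t) t0.
exists p, q; split => //.
- by move=> t x t0; rewrite pE// qE.
- by move=> t x t0 xI; have [h _] := AP t t0; exact: h.
- by move=> t t0; have [_ h] := AP t t0; exact: h.
Qed.

Lemma bounds_linear (nu : R) : 0 <= nu <= 1 ->
  rho_bound nu <= rho_bound 1 * nu /\ kin_bound nu <= kin_bound 1 * nu.
Proof.
move=> /andP[nu0 nu1].
have nu2 : nu ^+ 2 <= nu by rewrite expr2 ler_piMl.
have r1 : rho_bound nu <= rho_bound 1 * nu by rewrite /rho_bound; lra.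
split=> //.
have r0 : 0 <= rho_bound 1 by rewrite /rho_bound !(addr_ge0, mulr_ge0, sqr_ge0).
have : rho_bound nu * (8 * nu) <= rho_bound 1 * nu * 8.
  have : rho_bound nu * (8 * nu) <= rho_bound 1 * nu * (8 * nu).
    by rewrite ler_wpM2r// mulr_ge0.
  by move=> /le_trans; apply; rewrite ler_wpM2l ?mulr_ge0//; lra.
rewrite /kin_bound; lra.
Qed.

Lemma rho_bound_ge0 (L : R) : 0 <= L -> 0 <= rho_bound L.
Proof. by move=> L0; rewrite /rho_bound !(addr_ge0, mulr_ge0, sqr_ge0). Qed.

Lemma kin_bound_ge0 (L : R) : 0 <= L -> 0 <= kin_bound L.
Proof.
move=> L0; have r0 := rho_bound_ge0 L0; rewrite /kin_bound.
by rewrite !(addr_ge0, mulr_ge0, sqr_ge0).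
Qed.

(** For data of squared size [nu] the kinetic energy is of order [nu], and with
    Gronwall rate [nu] the squared L^2 distance to the free flow is of order
    [nu exp(nu t) (nu t)]. In Agmon's inequality a large parameter makes the kinetic
    contribution a small multiple of [nu]; a small value of [nu t] then does the
    same for the L^2 contribution. *)
Lemma nls_near_trig (e : R) : 0 < e -> exists2 k, 0 < k &
  forall (u0 : R -> R[i]) u (a b c d nu t x : R), nls_solution u0 u -> trig_datum u0 a b c d ->
    size4 a b c d <= nu -> 0 < nu <= 1 -> 0 <= t -> nu * t <= k -> 0 <= x <= 2 * pi ->
    (complex.Re (u t x) - trig_wave a b c d t x) ^+ 2 +
    (complex.Im (u t x) - trig_wave c d (- a) (- b) t x) ^+ 2 <= e * nu.
Proof.
move=> e0.
have := kin_bound_ge0 (@ler01 R); have := rho_bound_ge0 (@ler01 R).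
have := bounds_linear; move: (rho_bound 1) (kin_bound 1) => cS cK lin cS0 cK0.
(* with this parameter the kinetic term is exactly half of [e nu] *)
pose m := 8 * (8 + cK) / e.
have m0 : 0 < m by rewrite divr_gt0// mulr_gt0// ltr_pwDl.
pose C := (1 + m) * (expR 1 * (4 * (1 + cS) ^+ 3 * 8)) : R.
have cS3 : 0 <= 4 * cS ^+ 3 by rewrite mulr_ge0// exprn_ge0.
have C0 : 0 < C.
  have ex : 0 < expR 1 :> R by exact: expR_gt0.
  have cS1 : 0 < (1 + cS) ^+ 3 by rewrite exprn_gt0// ltr_pwDl.
  by rewrite /C mulr_gt0 ?addr_gt0// mulr_gt0// mulr_gt0// mulr_gt0.
exists (Num.min 1 (e / (2 * C))).
  by rewrite lt_min ltr01/= divr_gt0// mulr_gt0.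
move=> u0 u a b c d nu t x sol u0E N_nu /andP[nu0 nu1] t0.
rewrite le_min => /andP[k1 k2] xI.
have [p [q [E pqE init rS kK]]] := nls_solution_bounds sol u0E N_nu.
set pf := trig_wave a b c d; set qf := trig_wave c d (- a) (- b).
have [SB KB] : rho_bound nu <= cS * nu /\ kin_bound nu <= cK * nu.
  by apply: lin; rewrite ltW.
have S0 : 0 <= cS * nu by rewrite mulr_ge0// ltW.
have rS' s y : 0 <= s -> 0 <= y <= 2 * pi -> rho p q s y <= cS * nu.
  by move=> s0 yI; exact: le_trans (rS s y s0 yI) SB.
have kp : kin p q t <= (8 + cK) * nu.
  apply: le_trans (kK t t0) (le_trans KB _).
  by rewrite ler_wpM2r ?(ltW nu0)// lerDr.
have kf : kin pf qf t <= (8 + cK) * nu.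
  apply: le_trans (kin_trig_le a b c d t) _.
  have : 0 <= cK * nu by rewrite mulr_ge0// ltW.
  have : 8 * size4 a b c d <= 8 * nu by rewrite ler_wpM2l.
  lra.
have p0 y : p 0 y = pf 0 y by rewrite (init y).1 /= cos0 sin0; ring.
have q0 y : q 0 y = qf 0 y by rewrite (init y).2 /= cos0 sin0; ring.
have := nls_near_free E (free_trig_wave a b c d) S0 rS' p0 q0 kp kf nu0 m0 t0 xI.
rewrite /rho /= (pqE t x t0).1 (pqE t x t0).2 => /le_trans; apply.
have -> : 4 * ((8 + cK) * nu) / m = nu * (e / 2).
  by rewrite /m; field; rewrite !gt_eqF// ltr_pwDl.
have -> : 4 * (cS * nu) ^+ 3 / nu * (2 * pi) * t =
    nu * (4 * cS ^+ 3 * (2 * pi) * (nu * t)).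
  by field; rewrite gt_eqF.
suff h : (1 + m) * (expR (nu * t) * (4 * cS ^+ 3 * (2 * pi))) * (nu * t) <= e / 2.
  have := ler_wpM2l (ltW nu0) h; lra.
apply: (@le_trans _ _ (C * (e / (2 * C)))); last first.
  by rewrite le_eqVlt; apply/orP; left; apply/eqP; field; rewrite gt_eqF.
have pi0 := @pi_gt0 R; have pi4 := pihalf_lt2 R.
have nut0 : 0 <= nu * t by rewrite mulr_ge0// ltW.
have m1 : 0 <= 1 + m by rewrite addr_ge0// ltW.
have pi20 : 0 <= 2 * pi :> R by rewrite mulr_ge0// ltW.
apply: ler_pM => //.
  by rewrite mulr_ge0// mulr_ge0 ?expR_ge0// mulr_ge0.
rewrite /C ler_wpM2l//.
apply: ler_pM; rewrite ?expR_ge0 ?ler_expR//; first by rewrite mulr_ge0.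
apply: ler_pM => //; last by lra.
by rewrite ler_wpM2l// lerXn2r ?nnegrE ?addr_ge0// lerDr.
Qed.

(** The mass distance of the solutions at time 0 is at most 8 times the size of the
    difference of the data, and Agmon's parameter is chosen large as before. *)
Lemma nls_solution_stability (L t e : R) : 0 <= L -> 0 <= t -> 0 < e ->
  exists2 k, 0 < k & forall (u0 : R -> R[i]) u (a b c d : R) (v0 : R -> R[i]) v (a' b' c' d' x : R),
    nls_solution u0 u -> trig_datum u0 a b c d -> size4 a b c d <= L ->
    nls_solution v0 v -> trig_datum v0 a' b' c' d' -> size4 a' b' c' d' <= L ->
    size4 (a - a') (b - b') (c - c') (d - d') <= k -> 0 <= x <= 2 * pi ->
    (complex.Re (u t x) - complex.Re (v t x)) ^+ 2 +
    (complex.Im (u t x) - complex.Im (v t x)) ^+ 2 <= e.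
Proof.
move=> L0 t0 e0.
have S0 : 0 <= rho_bound L.
  by rewrite /rho_bound; rewrite !(addr_ge0, mulr_ge0, sqr_ge0)//.
have K0 : 0 <= kin_bound L.
  by rewrite /kin_bound addr_ge0// mulr_ge0// ?mulr_ge0// addr_ge0// sqr_ge0.
pose m := 8 * (1 + kin_bound L) / e.
have m0 : 0 < m by rewrite divr_gt0// mulr_gt0// ltr_pwDl.
pose C := (1 + m) * (expR (10 * rho_bound L * t) * 8).
have C0 : 0 < C.
  by rewrite /C mulr_gt0 ?addr_gt0// mulr_gt0// expR_gt0.
exists (e / (2 * C)); first by rewrite divr_gt0// mulr_gt0.
move=> u0 u a b c d v0 v a' b' c' d' x su du Lu sv dv Lv Nk xI.
have [p1 [q1 [E1 pq1 i1 r1 k1]]] := nls_solution_bounds su du Lu.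
have [p2 [q2 [E2 pq2 i2 r2 k2]]] := nls_solution_bounds sv dv Lv.
have := nls_stability E1 E2 S0 r1 r2 (k1 t t0) (k2 t t0) m0 t0 xI.
rewrite /rho /= (pq1 t x t0).1 (pq1 t x t0).2 (pq2 t x t0).1 (pq2 t x t0).2.
move=> /le_trans; apply.
set N := size4 (a - a') (b - b') (c - c') (d - d') in Nk.
have m8 : mass (wave_sub p1 p2) (wave_sub q1 q2) 0 <= 8 * N.
  apply: circ_le_cst; [exact: continuous_rho|move=> y|exact: size4_ge0].
  rewrite /rho /= (i1 y).1 (i1 y).2 (i2 y).1 (i2 y).2.
  have := lerD (trig_sqr_le (a - a') (b - b') y) (trig_sqr_le (c - c') (d - d') y).
  rewrite addrA -/N; apply: le_trans.
  by rewrite le_eqVlt; apply/orP; left; apply/eqP; ring.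
have h1 : 4 * kin_bound L / m <= e / 2.
  rewrite ler_pdivrMr// /m.
  have -> : e / 2 * (8 * (1 + kin_bound L) / e) = 4 * (1 + kin_bound L).
    by field; rewrite gt_eqF.
  lra.
have h2 : (1 + m) * (expR (10 * rho_bound L * t) *
    mass (wave_sub p1 p2) (wave_sub q1 q2) 0) <= C * N.
  rewrite /C -!mulrA ler_wpM2l ?addr_ge0 ?(ltW m0)//.
  by rewrite ler_wpM2l ?expR_ge0.
have h3 : C * N <= e / 2.
  have -> : e / 2 = C * (e / (2 * C)) by field; rewrite gt_eqF.
  by rewrite ler_wpM2l ?(ltW C0).
lra.
Qed.
End consequences.

(** * Gaussian tails *)

Section tails.
Context {R : realType}.
Local Notation mu := (@lebesgue_measure R).

Lemma normal_fun0E (s x : R) : normal_fun 0 s x = expR (- (x ^+ 2 / (s ^+ 2 * 2))).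
Proof. by rewrite /normal_fun subr0 mulr_natr mulNr. Qed.

(** A fraction [1 - k] of the exponent is kept to make the integral converge: what
    remains is the density of another normal law. *)
Lemma normal_tail (s k : R) : 0 < s -> 0 < k < 1 -> exists2 C, 0 <= C &
  forall (y : R) (A : set R), measurable A ->
    (forall x, A x -> y <= x ^+ 2 / (s ^+ 2 * 2)) ->
    (normal_prob 0%R s A <= (C * expR (- (k * y)))%:E)%E.
Proof.
move=> s0 /andP[k0 k1].
pose s' := s / Num.sqrt (1 - k).
have k1' : 0 < 1 - k by lra.
have sq0 : 0 < Num.sqrt (1 - k) by rewrite sqrtr_gt0.
have s'0 : 0 < s' by rewrite divr_gt0.
have s'2 : s' ^+ 2 = s ^+ 2 / (1 - k) by rewrite expr_div_n sqr_sqrtr ?ltW.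
have p0 : 0 < normal_peak s by rewrite normal_peak_gt0 ?gt_eqF.
have p'0 : 0 < normal_peak s' by rewrite normal_peak_gt0 ?gt_eqF.
pose C := normal_peak s / normal_peak s'.
have C0 : 0 <= C by rewrite divr_ge0 ?ltW.
exists C => // y A mA Ay.
have D0 : 0 <= C * expR (- (k * y)) by rewrite mulr_ge0 ?expR_ge0.
have mpdf (z : R) : measurable_fun A (EFin \o normal_pdf 0 z).
  by apply/measurable_EFinP; apply: measurable_funTS; exact: measurable_normal_pdf.
apply: (@le_trans _ _ (\int[mu]_(x in A) ((C * expR (- (k * y)))%:E * (normal_pdf 0 s' x)%:E))%E).
  apply: ge0_le_integral => //.
  - by move=> x _; rewrite lee_fin normal_pdf_ge0.
  - exact: mpdf.
  - by apply: measurable_funeM; exact: mpdf.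
  move=> x Ax; rewrite -EFinM lee_fin !normal_pdfE ?gt_eqF// !normal_fun0E.
  rewrite mulrACA /C divfK ?gt_eqF// -mulrA ler_wpM2l ?(ltW p0)// -expRD ler_expR s'2.
  have -> : x ^+ 2 / (s ^+ 2 / (1 - k) * 2) = x ^+ 2 / (s ^+ 2 * 2) - k * (x ^+ 2 / (s ^+ 2 * 2)).
    by field; rewrite !gt_eqF// ?exprn_gt0// mulr_gt0// exprn_gt0.
  have := ler_wpM2l (ltW k0) (Ay x Ax); lra.
rewrite ge0_integralZl//; last 2 first.
- exact: mpdf.
- by move=> x _; rewrite lee_fin normal_pdf_ge0.
rewrite -[leRHS]mule1 lee_wpmul2l ?lee_fin//.
rewrite -(@integral_normal_pdf R 0 s').
apply: ge0_subset_integral => //.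
- by apply/measurable_EFinP; exact: measurable_normal_pdf.
- by move=> x _; rewrite lee_fin normal_pdf_ge0.
Qed.

Lemma normal_prob_itv_ge (s a : R) : 0 < s -> 0 <= a ->
  ((normal_peak s * expR (- ((a + 1) ^+ 2 / (s ^+ 2 * 2))))%:E <=
   normal_prob 0%R s `[a, (a + 1)%R]%classic)%E.
Proof.
move=> s0 a0; set c := (_ * _).
have p0 : 0 < normal_peak s by rewrite normal_peak_gt0 ?gt_eqF.
have -> : c%:E = (\int[mu]_(x in `[a, (a + 1)%R]) (cst c%:E x))%E.
  rewrite integral_cst//= lebesgue_measure_itv/= lte_fin ltrDl ltr01.
  by rewrite -EFinD addrAC subrr add0r mule1.
apply: ge0_le_integral => //.
- by move=> x _; rewrite lee_fin mulr_ge0 ?expR_ge0 ?ltW.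
- by apply/measurable_EFinP; apply: measurable_funTS; exact: measurable_normal_pdf.
move=> x; rewrite /= in_itv/= => /andP[ax xa].
rewrite lee_fin normal_pdfE ?gt_eqF// normal_fun0E ler_wpM2l ?(ltW p0)//.
rewrite ler_expR lerN2; apply: ler_wpM2r.
  by rewrite invr_ge0 mulr_ge0// sqr_ge0.
by rewrite lerXn2r ?nnegrE//; lra.
Qed.

Context {d : measure_display} {T : measurableType d} (P : probability T R).

Lemma prob_bigsetU_le (F : nat -> set T) (c : R) n :
  (forall k, (k < n)%N -> measurable (F k)) ->
  (forall k, (k < n)%N -> (P (F k) <= c%:E)%E) ->
  measurable (\big[setU/set0]_(k < n) F k) /\
  (P (\big[setU/set0]_(k < n) F k) <= (n%:R * c)%:E)%E.
Proof.
elim: n => [|n IH] mF Fc.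
  by rewrite big_ord0 measure0 mul0r.
have [m1 m2] := IH (fun k kn => mF k (ltnW kn)) (fun k kn => Fc k (ltnW kn)).
rewrite big_ord_recr/=; split; first by apply: measurableU => //; exact: mF.
apply: le_trans (measureU2 _ m1 (mF _ _)) _ => //.
by rewrite -natr1 mulrDl mul1r EFinD leeD// Fc.
Qed.

Lemma grid_point (x h : R) n : 0 <= x -> x < n%:R * h ->
  exists k, [/\ (k < n)%N, k%:R * h <= x & x < k.+1%:R * h].
Proof.
move=> x0; elim: n => [|n IH xn]; first by rewrite mul0r ltNge x0.
have [/IH[k [kn k1 k2]]|nx] := ltP x (n%:R * h).
  by exists k; split => //; exact: ltnW.
by exists n.
Qed.

(** If [X + Y >= y] then either [X >= y], or [X] lies in some cell of the grid of
    mesh [h = y / n] and [Y] makes up for the rest up to one mesh. Each of these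
    [n + 1] events has probability at most [C exp(- k (y - h))], so that passing to
    sums costs an arbitrarily small part of the rate. *)
Lemma exp_tail_add (X Y : T -> R) (k k' C : R) :
  (forall w, 0 <= X w) -> (forall w, 0 <= Y w) -> 0 <= C -> 0 < k' < k ->
  (forall y, measurable [set w | y <= X w]) ->
  (forall y, measurable [set w | y <= Y w]) ->
  (forall y1 y2, 0 <= y1 -> 0 <= y2 ->
    (P ([set w | y1 <= X w]%R `&` [set w | y2 <= Y w]%R) <=
      (C * expR (- (k * (y1 + y2))))%:E)%E) ->
  exists2 C', 0 <= C' & forall y, 0 <= y -> forall A, measurable A ->
    (forall w, A w -> y <= X w + Y w) ->
    (P A <= (C' * expR (- (k' * y)))%:E)%E.
Proof.
move=> X0 Y0 C0 /andP[k'0 k'k] mX mY joint.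
have k0 : 0 < k by lra.
(* enough grid points for the loss of one mesh to be absorbed by [k - k'] *)
pose n := (Num.truncn (k / (k - k'))).+1.
have kn : k < n%:R * (k - k').
  by rewrite -ltr_pdivrMr ?subr_gt0// /n real_truncnS_gt ?num_real.
have n0 : 0 < n%:R :> R by rewrite ltr0n.
exists ((n.+1)%:R * C); first by rewrite mulr_ge0.
move=> y y0 A mA AXY.
pose h := y / n%:R.
have h0 : 0 <= h by rewrite divr_ge0// ltW.
have nh : n%:R * h = y by rewrite /h mulrC divfK// gt_eqF.
pose F i := [set w | i%:R * h <= X w] `&` [set w | (n.-1 - i)%:R * h <= Y w].
have mF i : measurable (F i) by exact: measurableI.
have Fc i : (i < n)%N -> (P (F i) <= (C * expR (- (k' * y)))%:E)%E.
  move=> i_n; apply: le_trans (joint _ _ _ _) _; rewrite ?mulr_ge0//.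
  rewrite lee_fin ler_wpM2l// ler_expR lerN2 -mulrDl -natrD subnKC//.
  have -> : (n.-1)%:R * h = y - h.
    by rewrite -nh -[in RHS](@prednK n)// -natr1 mulrDl mul1r addrK.
  rewrite mulrBr; suff : k * h <= y * (k - k') by lra.
  rewrite -nh [n%:R * h]mulrC -mulrA [k * h]mulrC ler_wpM2l// ltW//.
have [mU UP] := prob_bigsetU_le (n := n) (fun i _ => mF i) Fc.
have PX : (P [set w | y <= X w]%R <= (C * expR (- (k' * y)))%:E)%E.
  have := joint y 0 y0 (lexx _).
  rewrite (_ : [set w | 0 <= Y w] = setT); last first.
    by apply/seteqP; split => w //= _.
  rewrite setIT addr0 => /le_trans; apply.
  by rewrite lee_fin ler_wpM2l// ler_expR lerN2 ler_wpM2r// ltW.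
have sub : A `<=` (\big[setU/set0]_(i < n) F i) `|` [set w | y <= X w].
  move=> w Aw; have XY := AXY w Aw.
  have [yX|Xy] := leP y (X w); first by right.
  left; rewrite -nh in Xy; have [i [i_n i1 i2]] := grid_point (X0 w) Xy.
  rewrite -bigcup_mkord; exists i => //=; split => //=.
  have : (n.-1 - i)%:R * h = y - i.+1%:R * h.
    by rewrite -nh -mulrBl -natrB.
  lra.
apply: (@le_trans _ _ (P ((\big[setU/set0]_(i < n) F i) `|` [set w | y <= X w]))).
  by apply: le_measure => //; rewrite inE//; apply: measurableU.
apply: le_trans (measureU2 _ mU (mX y)) _.
rewrite -natr1 2!mulrDl mul1r EFinD leeD// -mulrA//.
Qed.

(** Each point of the strict sublevel set lies in the preimage of a small box with
    rational centre on which [F < c] still holds. The sublevel set is thus a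
    countable union of preimages of boxes, although [F] is a function of the four
    coordinates only on the set of values that they take. *)
Lemma measurable_continuous_dependence (f1 f2 f3 f4 F : T -> R) (c : R) :
  measurable_fun setT f1 -> measurable_fun setT f2 ->
  measurable_fun setT f3 -> measurable_fun setT f4 ->
  (forall w e, 0 < e -> exists2 k, 0 < k & forall w',
    `|f1 w - f1 w'| < k -> `|f2 w - f2 w'| < k -> `|f3 w - f3 w'| < k ->
    `|f4 w - f4 w'| < k -> F w' <= F w + e) ->
  measurable [set w | c <= F w].
Proof.
move=> m1 m2 m3 m4 cont.
pose I : Type := (rat * rat * rat * rat * nat)%type.
pose B (f : T -> R) (q : rat) (n : nat) := f @^-1` (ball (ratr q : R) (n.+1%:R^-1)).
have mB f q n : measurable_fun setT f -> measurable (B f q n).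
  by move=> mf; rewrite -[B f q n]setTI; apply: mf => //; exact: measurable_ball.
pose Q (i : I) := B f1 i.1.1.1.1 i.2 `&` B f2 i.1.1.1.2 i.2 `&`
   (B f3 i.1.1.2 i.2 `&` B f4 i.1.2 i.2).
have mQ i : measurable (Q i).
  by apply: measurableI; apply: measurableI; exact: mB.
pose G (i : I) := if `[< Q i `<=` [set w | F w < c] >] then Q i else set0.
rewrite (_ : [set w | c <= F w] = ~` \bigcup_i G i).
  apply: measurableC; apply: countable_bigcupT_measurable.
    exact: countableP.
  by move=> i; rewrite /G; case: asboolP.
apply/seteqP; split => [w /= cF [i _]|w /= nG].
  by rewrite /G; case: asboolP => // sub /sub /=; rewrite ltNge cF.
rewrite leNgt; apply/negP => Fc; apply: nG.
have gap : 0 < (c - F w) / 2 by rewrite divr_gt0// subr_gt0.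
have [k k0 kP] := cont w _ gap.
pose n := Num.truncn (2 / k).
have nk : n.+1%:R^-1 < k / 2.
  rewrite -[ltRHS]invrK ltf_pV2 ?posrE ?invr_gt0 ?divr_gt0 ?ltr0n// invf_div.
  by rewrite /n real_truncnS_gt ?num_real.
have rat_near (x : R) : exists q : rat, ball (ratr q : R) (n.+1%:R^-1) x.
  have n1 : 0 < n.+1%:R^-1 :> R by rewrite invr_gt0 ltr0n.
  move: (n.+1%:R^-1) n1 => h n1.
  have xx : x - h < x + h by lra.
  have [q] := rat_in_itvoo xx; rewrite in_itv/= => /andP[q1 q2].
  by exists q; rewrite /ball/= ltr_distlC; apply/andP; split; lra.
have [q1 h1] := rat_near (f1 w); have [q2 h2] := rat_near (f2 w).
have [q3 h3] := rat_near (f3 w); have [q4 h4] := rat_near (f4 w).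
exists (q1, q2, q3, q4, n) => //.
have close (f : T -> R) q w' : ball (ratr q : R) (n.+1%:R^-1) (f w) ->
    B f q n w' -> `|f w - f w'| < k.
  rewrite /B /= => b1 b2.
  have := ler_distD (ratr q) (f w) (f w').
  move: (n.+1%:R^-1) nk b1 b2 => h nk; rewrite /ball/= [`|f w - ratr q|]distrC; lra.
rewrite /G; case: asboolP => [_|[]].
  by [].
move=> w' [[/= b1 b2] [/= b3 b4]] /=.
have := kP w' (close _ _ _ h1 b1) (close _ _ _ h2 b2) (close _ _ _ h3 b3) (close _ _ _ h4 b4).
lra.
Qed.
End tails.

(** * The sup norm of the solution and the size of its data *)

Section sup_norm.
Context {R : realType}.
Implicit Types (u v : R -> R -> R[i]).

Definition datum (eps : R) (al be : R[i]) (x : R) : R[i] :=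
  eps%:C * (al * cexpi x + be * cexpi (- x)).

Definition nsq (z : R[i]) : R := complex.Re z ^+ 2 + complex.Im z ^+ 2.

Lemma nsq_ge0 z : 0 <= nsq z.
Proof. by rewrite addr_ge0 ?sqr_ge0. Qed.

Lemma normc_nsq (z : R[i]) : Normc.normc z = Num.sqrt (nsq z).
Proof. by case: z. Qed.

Lemma normc_le (z : R[i]) (A : R) : 0 <= A -> nsq z <= A ^+ 2 -> Normc.normc z <= A.
Proof.
by move=> A0 zA; rewrite normc_nsq -(ger0_norm A0) -sqrtr_sqr ler_wsqrtr.
Qed.

Lemma normc_ge (z : R[i]) (A : R) : 0 <= A -> A ^+ 2 <= nsq z -> A <= Normc.normc z.
Proof.
by move=> A0 zA; rewrite normc_nsq -(ger0_norm A0) -sqrtr_sqr ler_wsqrtr.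
Qed.

Lemma normc_close (z f : R[i]) (e : R) : 0 <= e -> nsq (z - f) <= e ^+ 2 ->
  Normc.normc z <= Normc.normc f + e /\ Normc.normc f <= Normc.normc z + e.
Proof.
move=> e0 /(normc_le e0) zf; split.
- rewrite -{1}(subrK f z) addrC; apply: le_trans (le_normcD _ _) _.
  by rewrite lerD2l.
- rewrite -{1}(subrK z f) addrC; apply: le_trans (le_normcD _ _) _.
  by rewrite lerD2l -opprB normcN.
Qed.

Lemma nsqB (z f : R[i]) : nsq (z - f) =
  (complex.Re z - complex.Re f) ^+ 2 + (complex.Im z - complex.Im f) ^+ 2.
Proof. by case: z f => [a b] [c d]. Qed.

Lemma trig_datum_datum (eps : R) (al be : R[i]) :
  trig_datum (datum eps al be)
    (eps * (complex.Re al + complex.Re be)) (eps * (complex.Im be - complex.Im al))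
    (eps * (complex.Im al + complex.Im be)) (eps * (complex.Re al - complex.Re be)).
Proof.
move=> x; case: al be => [a1 a2] [b1 b2]; rewrite /datum /cexpi cosN sinN /=.
by simpc => /=; split; ring.
Qed.

Definition dsize (eps : R) (al be : R[i]) : R := 2 * eps ^+ 2 * (nsq al + nsq be).

Lemma size4_datum (eps : R) (al be : R[i]) :
  size4 (eps * (complex.Re al + complex.Re be)) (eps * (complex.Im be - complex.Im al))
    (eps * (complex.Im al + complex.Im be)) (eps * (complex.Re al - complex.Re be))
  = dsize eps al be.
Proof. by rewrite /size4 /dsize /nsq; ring. Qed.

Lemma size4_datum_le (eps L : R) (al be : R[i]) : dsize eps al be <= L ->
  size4 (eps * (complex.Re al + complex.Re be)) (eps * (complex.Im be - complex.Im al))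
    (eps * (complex.Im al + complex.Im be)) (eps * (complex.Re al - complex.Re be))
  <= L.
Proof. by rewrite size4_datum. Qed.

Lemma sup_torus_le (f : R -> R[i]) (c : R) :
  (forall x, 0 <= x <= 2 * pi -> Normc.normc (f x) <= c) -> sup_torus f <= c.
Proof.
move=> fc; apply: ge_sup.
  by exists (Normc.normc (f 0)), 0 => //; rewrite /= in_itv/= lexx ltW// twopi_gt0.
by move=> _ [x /= xI <-]; apply: fc; rewrite in_itv/= in xI.
Qed.

Lemma sup_torus_ge (f : R -> R[i]) (B x : R) :
  (forall x, 0 <= x <= 2 * pi -> Normc.normc (f x) <= B) -> 0 <= x <= 2 * pi ->
  Normc.normc (f x) <= sup_torus f.
Proof.
move=> fB xI; apply: ub_le_sup; last by exists x => //=; rewrite in_itv.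
by exists B => _ [y /= yI <-]; apply: fB; rewrite in_itv/= in yI.
Qed.

Lemma nls_solution_sup_bounded (eps : R) (al be : R[i]) u (t : R) :
  nls_solution (datum eps al be) u -> 0 <= t ->
  exists B, forall x, 0 <= x <= 2 * pi -> Normc.normc (u t x) <= B.
Proof.
move=> sol t0; have N_le := size4_datum_le (lexx (dsize eps al be)).
have [p [q [_ pq _ r _]]] := nls_solution_bounds sol (@trig_datum_datum eps al be) N_le.
exists (Num.sqrt (rho_bound (dsize eps al be))) => x xI.
rewrite normc_nsq; apply: ler_wsqrtr; have := r t x t0 xI.
by rewrite /rho (pq t x t0).1 (pq t x t0).2.
Qed.

(** Cauchy-Schwarz with the weights [sa], [sb], applied to the real and imaginary
    parts of [alpha exp(ix) + beta exp(-ix)]. *)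
Lemma free_modulus_le (sa sb : R) (al be : R[i]) (x eps : R) : 0 < sa -> 0 < sb ->
  nsq (datum eps al be x) <=
  eps ^+ 2 * ((sa ^+ 2 + sb ^+ 2) * (nsq al / sa ^+ 2 + nsq be / sb ^+ 2)).
Proof.
move=> sa0 sb0.
have CS (p q : R) : (p + q) ^+ 2 <= (sa ^+ 2 + sb ^+ 2) * (p ^+ 2 / sa ^+ 2 + q ^+ 2 / sb ^+ 2).
  have -> : (sa ^+ 2 + sb ^+ 2) * (p ^+ 2 / sa ^+ 2 + q ^+ 2 / sb ^+ 2) =
    (p + q) ^+ 2 + (sb * p / sa - sa * q / sb) ^+ 2.
    by field; rewrite !gt_eqF.
  by rewrite lerDl sqr_ge0.
case: al be => [a1 a2] [b1 b2]; rewrite /datum /cexpi cosN sinN /=; simpc.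
have e := cos2Dsin2 x; move: (cos x) (sin x) e => c s e; rewrite /nsq /=.
have h1 := CS (a1 * c - a2 * s) (b1 * c + b2 * s).
have h2 := CS (a1 * s + a2 * c) (b2 * c - b1 * s).
have -> : a1 ^+ 2 + a2 ^+ 2 = (a1 * c - a2 * s) ^+ 2 + (a1 * s + a2 * c) ^+ 2.
  transitivity ((a1 ^+ 2 + a2 ^+ 2) * (c ^+ 2 + s ^+ 2)); first by rewrite e mulr1.
  by ring.
have -> : b1 ^+ 2 + b2 ^+ 2 = (b1 * c + b2 * s) ^+ 2 + (b2 * c - b1 * s) ^+ 2.
  transitivity ((b1 ^+ 2 + b2 ^+ 2) * (c ^+ 2 + s ^+ 2)); first by rewrite e mulr1.
  by ring.
have h3 := ler_wpM2l (sqr_ge0 eps) (lerD h1 h2).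
apply: le_trans (le_trans h3 _); rewrite le_eqVlt; apply/orP; left; apply/eqP; ring.
Qed.

(** The free evolution has at each point the modulus of the data. *)
Lemma nls_modulus_near (e : R) : 0 < e -> exists2 k, 0 < k &
  forall (eps nu t x : R) (al be : R[i]) u,
    nls_solution (datum eps al be) u -> dsize eps al be <= nu ^+ 2 ->
    0 < nu <= 1 -> 0 <= t -> nu ^+ 2 * t <= k -> 0 <= x <= 2 * pi ->
    Normc.normc (u t x) <= Normc.normc (datum eps al be x) + e * nu /\
    Normc.normc (datum eps al be x) <= Normc.normc (u t x) + e * nu.
Proof.
move=> e0; have e20 : 0 < e ^+ 2 by rewrite exprn_gt0.
have [k k0 near] := nls_near_trig e20; exists k => // eps nu t x al be u sol N_nu.
move=> /andP[nu0 nu1] t0 tk xI.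
set D := datum eps al be x.
set a := eps * (complex.Re al + complex.Re be).
set b := eps * (complex.Im be - complex.Im al).
set c := eps * (complex.Im al + complex.Im be).
set d := eps * (complex.Re al - complex.Re be).
have du : trig_datum (datum eps al be) a b c d by exact: trig_datum_datum.
have sN : size4 a b c d <= nu ^+ 2 by rewrite size4_datum.
have nu2 : 0 < nu ^+ 2 <= 1 by rewrite exprn_gt0//= exprn_ile1// ltW.
have := near _ _ _ _ _ _ _ _ _ sol du sN nu2 t0 tk xI.
pose f : R[i] := trig_wave a b c d t x +i* trig_wave c d (- a) (- b) t x.
have -> : Normc.normc D = Normc.normc f.
  rewrite !normc_nsq; congr Num.sqrt.
  have -> : nsq f = rho (trig_wave a b c d) (trig_wave c d (- a) (- b)) t x by [].
  by rewrite rho_trig /nsq (du x).1 (du x).2.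
move=> h; have := @normc_close (u t x) f (e * nu); apply.
  by rewrite mulr_ge0 ?ltW.
by rewrite nsqB exprMn.
Qed.

(** Contrapositively, data below this level have squared size at most
    [2 z0^2 r^2]; their modulus stays below [(1 - eta) z0 r], and the comparison with
    the free flow, with [nu = sqrt 2 z0 r], costs at most [eta z0 r / 2]. *)
Lemma exceed_imp_large (z0 sa sb eta : R) : 0 < z0 -> 0 < sa -> 0 < sb ->
  0 < eta < 1 -> exists2 k, 0 < k &
  forall (r s t : R) (al be : R[i]) u, 0 < r -> 0 < s ->
    nls_solution (datum (r * s) al be) u -> 2 * z0 ^+ 2 * r ^+ 2 <= 1 -> 0 <= t ->
    2 * z0 ^+ 2 * r ^+ 2 * t <= k -> z0 * r <= sup_torus (u t) ->
    (1 - eta) ^+ 2 * (z0 ^+ 2 / (sa ^+ 2 + sb ^+ 2)) / s ^+ 2 <=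
    nsq al / sa ^+ 2 + nsq be / sb ^+ 2.
Proof.
move=> z00 sa0 sb0 /andP[eta0 eta1].
have e0 : 0 < eta / 4 by rewrite divr_gt0.
have [k k0 near] := nls_modulus_near e0; exists k => // r s t al be u r0 s0 sol.
have sq2 : Num.sqrt 2 ^+ 2 = 2 :> R by rewrite sqr_sqrtr.
have sq20 : 0 < Num.sqrt 2 :> R by rewrite sqrtr_gt0.
have sq2_le2 : Num.sqrt 2 <= 2 :> R by nra.
pose nu := Num.sqrt 2 * z0 * r.
have nu0 : 0 < nu by rewrite !mulr_gt0.
have nuE : nu ^+ 2 = 2 * z0 ^+ 2 * r ^+ 2 by rewrite /nu !exprMn sq2.
rewrite -nuE => nu1 t0 tk zsup.
have {}nu1 : 0 < nu <= 1.
  by rewrite nu0 /= -(@ler_pXn2r _ 2) ?nnegrE ?(ltW nu0)// expr1n.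
rewrite leNgt; apply/negP => small.
have sa2 : 0 < sa ^+ 2 by rewrite exprn_gt0.
have sb2 : 0 < sb ^+ 2 by rewrite exprn_gt0.
have S0 : 0 < sa ^+ 2 + sb ^+ 2 by rewrite addr_gt0.
have s20 : 0 < s ^+ 2 by rewrite exprn_gt0.
set X := nsq al / sa ^+ 2 + nsq be / sb ^+ 2 in small.
have SX : (sa ^+ 2 + sb ^+ 2) * X <= (1 - eta) ^+ 2 * z0 ^+ 2 / s ^+ 2.
  have := ler_wpM2l (ltW S0) (ltW small); move=> /le_trans; apply.
  by rewrite le_eqVlt; apply/orP; left; apply/eqP; field; rewrite !gt_eqF.
have eta2 : (1 - eta) ^+ 2 <= 1 by rewrite exprn_ile1//; lra.
have N_nu : dsize (r * s) al be <= nu ^+ 2.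
  have NX : nsq al + nsq be <= (sa ^+ 2 + sb ^+ 2) * X.
    have -> : (sa ^+ 2 + sb ^+ 2) * X = nsq al + nsq be +
        (sb ^+ 2 / sa ^+ 2 * nsq al + sa ^+ 2 / sb ^+ 2 * nsq be).
      by rewrite /X; field; rewrite !gt_eqF.
    by rewrite lerDl addr_ge0// mulr_ge0 ?nsq_ge0// divr_ge0 ?sqr_ge0.
  have N1 : nsq al + nsq be <= z0 ^+ 2 / s ^+ 2.
    apply: le_trans NX (le_trans SX _).
    by rewrite ler_wpM2r ?invr_ge0 ?sqr_ge0// ler_piMl ?sqr_ge0.
  rewrite /dsize nuE.
  have := ler_wpM2l (mulr_ge0 (ler0n R 2) (sqr_ge0 (r * s))) N1.
  move=> /le_trans; apply.
  by rewrite le_eqVlt; apply/orP; left; apply/eqP; field; rewrite !gt_eqF.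
have bound x : 0 <= x <= 2 * pi -> Normc.normc (u t x) <= (1 - eta / 2) * (z0 * r).
  move=> xI; have [h _] := near _ _ _ _ _ _ _ sol N_nu nu1 t0 tk xI.
  apply: (le_trans h).
  have D_le : Normc.normc (datum (r * s) al be x) <= (1 - eta) * (z0 * r).
    apply: normc_le; first by rewrite !mulr_ge0 ?ltW//; lra.
    apply: le_trans (free_modulus_le _ _ _ _ sa0 sb0) _.
    have := ler_wpM2l (sqr_ge0 (r * s)) SX; move=> /le_trans; apply.
    by rewrite le_eqVlt; apply/orP; left; apply/eqP; field; rewrite !gt_eqF.
  have : eta / 4 * nu <= eta / 2 * (z0 * r).
    rewrite /nu; have := ler_wpM2r (ltW (mulr_gt0 (mulr_gt0 e0 z00) r0)) sq2_le2.
    lra.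
  lra.
have := le_trans zsup (sup_torus_le bound).
have : 0 < eta / 2 * (z0 * r) by rewrite !mulr_gt0// divr_gt0.
lra.
Qed.

(** In such a box the two amplitudes nearly add up at [x = 0], where the modulus of
    the data is at least [r s (A / s + B / s)]. *)
Lemma box_imp_exceed (A B e : R) : 0 <= A -> 0 <= B -> 0 < e ->
  exists C k, [/\ 0 < C, 0 < k &
  forall (r s t : R) (al be : R[i]) u, 0 < r -> 0 < s -> s <= 1 ->
    nls_solution (datum (r * s) al be) u -> C * r ^+ 2 <= 1 -> 0 <= t ->
    C * r ^+ 2 * t <= k ->
    A / s <= complex.Re al <= A / s + 1 -> 0 <= complex.Im al <= 1 ->
    B / s <= complex.Re be <= B / s + 1 -> 0 <= complex.Im be <= 1 ->
    (A + B - e) * r <= sup_torus (u t)].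
Proof.
move=> A0 B0 e0.
(* [(c r)^2] bounds the squared size of the data, because [s <= 1] *)
have [c cE] : exists c, c = 2 * (A + B + 4) by exists (2 * (A + B + 4)).
have c0 : 0 < c by rewrite cE; lra.
have e10 : 0 < e / c by rewrite divr_gt0.
have [k k0 near] := nls_modulus_near e10; exists (c ^+ 2), k.
split => //; first by rewrite exprn_gt0.
move=> r s t al be u r0 s0 s1 sol; rewrite -exprMn => nu1 t0 tk.
move=> /andP[a1 a2] /andP[a3 a4] /andP[b1 b2] /andP[b3 b4].
have nu0 : 0 < c * r by rewrite mulr_gt0.
have {}nu1 : 0 < c * r <= 1.
  by rewrite nu0 /= -(@ler_pXn2r _ 2) ?nnegrE ?(ltW nu0)// expr1n.
have sA : A / s * s = A by rewrite divfK ?gt_eqF.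
have sB : B / s * s = B by rewrite divfK ?gt_eqF.
have As0 : 0 <= A / s by rewrite divr_ge0// ltW.
have Bs0 : 0 <= B / s by rewrite divr_ge0// ltW.
have N_nu : dsize (r * s) al be <= (c * r) ^+ 2.
  have -> : dsize (r * s) al be = r ^+ 2 * (2 * ((s * complex.Re al) ^+ 2 +
      (s * complex.Im al) ^+ 2 + (s * complex.Re be) ^+ 2 + (s * complex.Im be) ^+ 2)).
    by rewrite /dsize /nsq; ring.
  rewrite [(c * r) ^+ 2]exprMn [c ^+ 2 * _]mulrC ler_wpM2l ?sqr_ge0//.
  have h1 : 0 <= s * complex.Re al <= A + 1.
    have := ler_wpM2l (ltW s0) a2; have := ler_wpM2l (ltW s0) a1; lra.
  have h2 : 0 <= s * complex.Re be <= B + 1.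
    have := ler_wpM2l (ltW s0) b2; have := ler_wpM2l (ltW s0) b1; lra.
  have h3 : 0 <= s * complex.Im al <= 1.
    have := ler_wpM2l (ltW s0) a3; have := ler_wpM2l (ltW s0) a4; lra.
  have h4 : 0 <= s * complex.Im be <= 1.
    have := ler_wpM2l (ltW s0) b3; have := ler_wpM2l (ltW s0) b4; lra.
  move: h1 h2 h3 h4; rewrite cE.
  move: (s * complex.Re al) (s * complex.Im al) (s * complex.Re be) (s * complex.Im be).
  move=> x1 x2 x3 x4 /andP[p1 p2] /andP[p3 p4] /andP[p5 p6] /andP[p7 p8].
  have q1 : x1 ^+ 2 <= (A + 1) ^+ 2 by rewrite lerXn2r ?nnegrE//; lra.
  have q2 : x3 ^+ 2 <= (B + 1) ^+ 2 by rewrite lerXn2r ?nnegrE//; lra.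
  have q3 : x2 ^+ 2 <= 1 by rewrite exprn_ile1.
  have q4 : x4 ^+ 2 <= 1 by rewrite exprn_ile1.
  have AB := mulr_ge0 A0 B0; nra.
have zI : 0 <= (0 : R) <= 2 * pi by rewrite lexx ltW// twopi_gt0.
have [_ h] := near _ _ _ _ _ _ _ sol N_nu nu1 t0 tk zI.
have D_ge : (A + B) * r <= Normc.normc (datum (r * s) al be 0).
  apply: normc_ge; first by rewrite mulr_ge0 ?(ltW r0)// addr_ge0.
  have [Dr Di] := trig_datum_datum (r * s) al be 0.
  rewrite /nsq Dr Di cos0 sin0 !mulr1 !mulr0 !addr0.
  apply: ler_wpDr; first exact: sqr_ge0.
  have le1 : (A + B) * r <= r * s * (complex.Re al + complex.Re be).
    have : A + B <= s * (complex.Re al + complex.Re be).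
      have := ler_wpM2l (ltW s0) a1; have := ler_wpM2l (ltW s0) b1; lra.
    by move=> /(ler_wpM2l (ltW r0)); lra.
  have ge0 : 0 <= (A + B) * r by rewrite mulr_ge0 ?(ltW r0)// addr_ge0.
  by rewrite lerXn2r ?nnegrE// (le_trans ge0).
have [M bM] := nls_solution_sup_bounded sol t0.
have := sup_torus_ge bM zI.
have : e / c * (c * r) = e * r by rewrite mulrA divfK ?gt_eqF.
lra.
Qed.

(** The event is measurable because the sup norm at a fixed time depends
    continuously on the two amplitudes. *)
Lemma measurable_exceed (d : measure_display) (T : measurableType d)
    (al be : T -> R[i]) (u : T -> R -> R -> R[i]) (eps t c : R) :
  measurable_fun setT (re_im al) -> measurable_fun setT (re_im be) ->
  0 <= t ->
  (forall w, nls_solution (datum eps (al w) (be w)) (u w)) ->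
  measurable [set w | c <= sup_torus (u w t)].
Proof.
move=> mal mbe t0 sol.
pose f1 w := complex.Re (al w); pose f2 w := complex.Im (al w).
pose f3 w := complex.Re (be w); pose f4 w := complex.Im (be w).
apply: (@measurable_continuous_dependence _ _ _ f1 f2 f3 f4).
- exact: (measurableT_comp measurable_fst mal).
- exact: (measurableT_comp measurable_snd mal).
- exact: (measurableT_comp measurable_fst mbe).
- exact: (measurableT_comp measurable_snd mbe).
move=> w e e0.
have e20 : 0 < e ^+ 2 by rewrite exprn_gt0.
set N := dsize eps (al w) (be w).
have N0 : 0 <= N.
  by apply: mulr_ge0; [rewrite mulr_ge0 ?sqr_ge0|rewrite addr_ge0 ?nsq_ge0].
have L0 : 0 <= 2 * N + 2 by lra.
have [k k0 stab] := nls_solution_stability L0 t0 e20.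
pose E := 8 * eps ^+ 2 + 1.
have E0 : 0 < E by rewrite /E; have := sqr_ge0 eps; lra.
pose m := Num.min 1 (Num.min 1 k / E).
have k10 : 0 < Num.min 1 k by rewrite lt_min ltr01 k0.
have m0 : 0 < m by rewrite lt_min ltr01 divr_gt0.
exists m => // w' c1 c2 c3 c4.
have m_le1 : m <= 1 by rewrite ge_min lexx.
have m_leE : E * m <= Num.min 1 k.
  by rewrite mulrC -ler_pdivlMr// ge_min lexx orbT.
pose al' := al w - al w'; pose be' := be w - be w'.
have d4 : dsize eps al' be' <= Num.min 1 k.
  have sq (x : R) : `|x| < m -> x ^+ 2 <= m.
    move=> xm; rewrite -real_normK ?num_real//.
    have : `|x| ^+ 2 <= m * `|x| by rewrite expr2 ler_wpM2r// ltW.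
    by move=> /le_trans; apply; rewrite ler_piMr ?ltW// (lt_le_trans xm).
  have h : nsq al' + nsq be' <= 4 * m.
    rewrite !nsqB; have := sq _ c1; have := sq _ c2; have := sq _ c3; have := sq _ c4.
    rewrite /f1 /f2 /f3 /f4; lra.
  have := ler_wpM2l (mulr_ge0 (ler0n R 2) (sqr_ge0 eps)) h.
  rewrite -/(dsize eps al' be') => /le_trans; apply.
  by apply: le_trans m_leE; rewrite /E; lra.
have N' : dsize eps (al w') (be w') <= 2 * N + 2.
  have d1 : dsize eps al' be' <= 1 by apply: (le_trans d4); rewrite ge_min lexx.
  have : dsize eps (al w') (be w') <= 2 * N + 2 * dsize eps al' be'.
    rewrite /N /dsize !nsqB /nsq; have := sqr_ge0 eps.
    have sq (x y : R) : 0 <= 2 * x ^+ 2 + 2 * (x - y) ^+ 2 - y ^+ 2.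
      by have := sqr_ge0 (2 * x - y); lra.
    move=> eps2; rewrite -subr_ge0.
    have := mulr_ge0 (mulr_ge0 (ler0n R 2) eps2)
      (addr_ge0 (addr_ge0 (sq (complex.Re (al w)) (complex.Re (al w')))
                   (sq (complex.Im (al w)) (complex.Im (al w'))))
          (addr_ge0 (sq (complex.Re (be w)) (complex.Re (be w')))
                   (sq (complex.Im (be w)) (complex.Im (be w'))))).
    lra.
  lra.
have [M bM] := nls_solution_sup_bounded (sol w) t0.
apply: sup_torus_le => x xI.
apply: le_trans (_ : Normc.normc (u w t x) + e <= _); last first.
  by rewrite lerD2r; exact: sup_torus_ge bM xI.
have NL : dsize eps (al w) (be w) <= 2 * N + 2 by rewrite -/N; lra.
have {}N' := size4_datum_le N'; have {}NL := size4_datum_le NL.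
have := stab _ _ _ _ _ _ _ _ _ _ _ _ x (sol w) (@trig_datum_datum _ _ _) NL
  (sol w') (@trig_datum_datum _ _ _) N' _ xI.
move=> h; have [] := @normc_close (u w t x) (u w' t x) e (ltW e0) _ => //.
rewrite nsqB; apply: h.
have : dsize eps al' be' <= k by apply: (le_trans d4); rewrite ge_min lexx orbT.
apply: le_trans; rewrite /dsize !nsqB /size4.
by rewrite le_eqVlt; apply/orP; left; apply/eqP; ring.
Qed.
End sup_norm.

(** * Large deviations of the data and conclusion *)

Section gaussian_data.
Context {R : realType} {d : measure_display} {T : measurableType d}.
Variable P : probability T R.
Implicit Types (eta : T -> R[i]).

Lemma measurable_ge (f : T -> R) (y : R) : measurable_fun setT f ->
  measurable [set w | y <= f w].
Proof.
move=> mf; rewrite (_ : [set w | y <= f w] = setT `&` f @^-1` `[y, +oo[).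
  by apply: mf => //; exact: measurable_itv.
by apply/seteqP; split => w /=; rewrite in_itv/= andbT; [split|case].
Qed.

Lemma measurable_Re eta : measurable_fun setT (re_im eta) ->
  measurable_fun setT (fun w => complex.Re (eta w)).
Proof. by move=> m; exact: (measurableT_comp measurable_fst m). Qed.

Lemma measurable_Im eta : measurable_fun setT (re_im eta) ->
  measurable_fun setT (fun w => complex.Im (eta w)).
Proof. by move=> m; exact: (measurableT_comp measurable_snd m). Qed.

Lemma measurable_nsq eta (c : R) : measurable_fun setT (re_im eta) ->
  measurable_fun setT (fun w => nsq (eta w) / c).
Proof.
move=> m; apply: measurable_funM => //.
apply: measurable_funD; apply: measurable_funX.
  exact: measurable_Re.
exact: measurable_Im.
Qed.

Lemma complex_gaussian_rect (s : R) eta (A B : set R) : complex_gaussian P s eta ->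
  measurable A -> measurable B ->
  P (re_im eta @^-1` (A `*` B)) =
  (normal_prob 0%R (s / Num.sqrt 2)%R A * normal_prob 0%R (s / Num.sqrt 2)%R B)%E.
Proof.
move=> [_ law] mA mB; rewrite law; last exact: measurableX.
by rewrite product_measure1E.
Qed.

Lemma half_variance (s : R) : (s / Num.sqrt 2) ^+ 2 * 2 = s ^+ 2.
Proof. by rewrite expr_div_n sqr_sqrtr// divfK. Qed.

(** Both squared components, divided by [s ^+ 2], have tails of rate arbitrarily
    close to 1. *)
Lemma complex_gaussian_tail (s k : R) eta : 0 < s -> 0 < k < 1 ->
  complex_gaussian P s eta -> exists2 C, 0 <= C & forall y, 0 <= y ->
  forall A, measurable A -> (forall w, A w -> y <= nsq (eta w) / s ^+ 2) ->
    (P A <= (C * expR (- (k * y)))%:E)%E.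
Proof.
move=> s0 /andP[k0 k1] G; have [meta _] := G.
have sig0 : 0 < s / Num.sqrt 2 by rewrite divr_gt0// sqrtr_gt0.
have k'1 : 0 < (1 + k) / 2 < 1 by apply/andP; split; lra.
have kk' : 0 < k < (1 + k) / 2 by apply/andP; split; lra.
have [C C0 tail] := normal_tail sig0 k'1.
pose X w := complex.Re (eta w) ^+ 2 / s ^+ 2.
pose Y w := complex.Im (eta w) ^+ 2 / s ^+ 2.
have X0 w : 0 <= X w by rewrite divr_ge0 ?sqr_ge0.
have Y0 w : 0 <= Y w by rewrite divr_ge0 ?sqr_ge0.
have mX y : measurable [set w | y <= X w].
  apply: measurable_ge; apply: measurable_funM => //.
  by apply: measurable_funX; exact: measurable_Re.
have mY y : measurable [set w | y <= Y w].
  apply: measurable_ge; apply: measurable_funM => //.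
  by apply: measurable_funX; exact: measurable_Im.
pose S (y : R) := [set x : R | y <= x ^+ 2 / s ^+ 2].
have mS y : measurable (S y).
  rewrite (_ : S y = setT `&` (fun x : R => x ^+ 2 / s ^+ 2) @^-1` `[y, +oo[).
    have mf : measurable_fun setT (fun x : R => x ^+ 2 / s ^+ 2).
      by apply: measurable_funM => //; apply: measurable_funX.
    by apply: mf => //; exact: measurable_itv.
  by apply/seteqP; split => w /=; rewrite in_itv/= andbT; [split|case].
have CC0 : 0 <= C * C by rewrite mulr_ge0.
have joint y1 y2 : 0 <= y1 -> 0 <= y2 ->
    (P ([set w | y1 <= X w]%R `&` [set w | y2 <= Y w]%R) <=
     (C * C * expR (- ((1 + k) / 2 * (y1 + y2))))%:E)%E.
  move=> y10 y20.
  have -> : [set w | y1 <= X w] `&` [set w | y2 <= Y w] =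
      re_im eta @^-1` (S y1 `*` S y2) by [].
  rewrite (complex_gaussian_rect G (mS y1) (mS y2)).
  have St y x : S y x -> y <= x ^+ 2 / ((s / Num.sqrt 2) ^+ 2 * 2).
    by rewrite half_variance.
  have t1 := tail y1 (S y1) (mS y1) (St y1).
  have t2 := tail y2 (S y2) (mS y2) (St y2).
  rewrite mulrDr opprD expRD mulrACA EFinM.
  by apply: lee_pmul.
have [C' C'0 h] := exp_tail_add X0 Y0 CC0 kk' mX mY joint.
exists C' => // y y0 A mA Ay; apply: h => // w /Ay.
by rewrite /nsq mulrDl.
Qed.

(** Independence factors the joint tails of the two normalised squared moduli. *)
Lemma data_tail (sa sb k : R) (al be : T -> R[i]) : 0 < sa -> 0 < sb -> 0 < k < 1 ->
  complex_gaussian P sa al -> complex_gaussian P sb be ->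
  independent_complex P al be -> exists2 C, 0 <= C & forall y, 0 <= y ->
  forall A, measurable A ->
    (forall w, A w -> y <= nsq (al w) / sa ^+ 2 + nsq (be w) / sb ^+ 2) ->
    (P A <= (C * expR (- (k * y)))%:E)%E.
Proof.
move=> sa0 sb0 /andP[k0 k1] Ga Gb ind.
have [ma _] := Ga; have [mb _] := Gb.
have k'1 : 0 < (1 + k) / 2 < 1 by apply/andP; split; lra.
have kk' : 0 < k < (1 + k) / 2 by apply/andP; split; lra.
have [Ca Ca0 ta] := complex_gaussian_tail sa0 k'1 Ga.
have [Cb Cb0 tb] := complex_gaussian_tail sb0 k'1 Gb.
have X0 (s : R) (eta : T -> R[i]) w : 0 <= nsq (eta w) / s ^+ 2.
  by rewrite divr_ge0 ?nsq_ge0 ?sqr_ge0.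
have mX y : measurable [set w | y <= nsq (al w) / sa ^+ 2].
  by apply: measurable_ge; exact: measurable_nsq.
have mY y : measurable [set w | y <= nsq (be w) / sb ^+ 2].
  by apply: measurable_ge; exact: measurable_nsq.
pose S (s y : R) := [set x : R * R | y <= (x.1 ^+ 2 + x.2 ^+ 2) / s ^+ 2].
have mS s y : measurable (S s y).
  rewrite (_ : S s y = setT `&` (fun x : R * R => (x.1 ^+ 2 + x.2 ^+ 2) / s ^+ 2) @^-1` `[y, +oo[).
    have mf : measurable_fun setT (fun x : R * R => (x.1 ^+ 2 + x.2 ^+ 2) / s ^+ 2).
      apply: measurable_funM => //; apply: measurable_funD; apply: measurable_funX.
        exact: measurable_fst.
      exact: measurable_snd.
    by apply: mf => //; exact: measurable_itv.
  by apply/seteqP; split => w /=; rewrite in_itv/= andbT; [split|case].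
have CC0 : 0 <= Ca * Cb by rewrite mulr_ge0.
apply: (exp_tail_add (X0 sa al) (X0 sb be) CC0 kk' mX mY) => y1 y2 y10 y20.
have := ind (S sa y1) (S sb y2) (mS _ _) (mS _ _).
rewrite (_ : re_im al @^-1` S sa y1 = [set w | y1 <= nsq (al w) / sa ^+ 2])//.
rewrite (_ : re_im be @^-1` S sb y2 = [set w | y2 <= nsq (be w) / sb ^+ 2])//.
move=> ->.
rewrite mulrDr opprD expRD mulrACA EFinM.
apply: lee_pmul => //.
- by apply: ta => //.
- by apply: tb => //.
Qed.

Lemma complex_gaussian_box (s : R) eta : 0 < s -> complex_gaussian P s eta ->
  exists2 c, 0 < c & forall a, 0 <= a ->
    ((c * expR (- ((a + 1) ^+ 2 / s ^+ 2)))%:E <=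
     P (re_im eta @^-1` (`[a, (a + 1)%R]%classic `*` `[0%R, 1%R]%classic)))%E.
Proof.
move=> s0 G.
have sig0 : 0 < s / Num.sqrt 2 by rewrite divr_gt0// sqrtr_gt0.
have p0 : 0 < normal_peak (s / Num.sqrt 2) by rewrite normal_peak_gt0// gt_eqF.
pose c1 := normal_peak (s / Num.sqrt 2).
exists (c1 * (c1 * expR (- ((0 + 1) ^+ 2 / s ^+ 2)))).
  by rewrite !mulr_gt0// expR_gt0.
move=> a a0; rewrite (complex_gaussian_rect G)//; try exact: measurable_itv.
have h1 := normal_prob_itv_ge sig0 a0.
have h2 := normal_prob_itv_ge sig0 (lexx 0).
rewrite half_variance in h1; rewrite half_variance in h2.
rewrite {2}add0r in h2.
rewrite mulrAC EFinM; apply: lee_pmul => //.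
  by rewrite lee_fin mulr_ge0 ?expR_ge0 ?(ltW p0).
by rewrite lee_fin mulr_ge0 ?expR_ge0 ?(ltW p0).
Qed.

Lemma data_box (sa sb : R) (al be : T -> R[i]) : 0 < sa -> 0 < sb ->
  complex_gaussian P sa al -> complex_gaussian P sb be ->
  independent_complex P al be -> exists2 c, 0 < c & forall a b, 0 <= a -> 0 <= b ->
  forall A, measurable A ->
    (forall w, a <= complex.Re (al w) <= a + 1 -> 0 <= complex.Im (al w) <= 1 ->
       b <= complex.Re (be w) <= b + 1 -> 0 <= complex.Im (be w) <= 1 -> A w) ->
    ((c * expR (- ((a + 1) ^+ 2 / sa ^+ 2 + (b + 1) ^+ 2 / sb ^+ 2)))%:E <= P A)%E.
Proof.
move=> sa0 sb0 Ga Gb ind; have [ma _] := Ga; have [mb _] := Gb.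
have [ca ca0 ha] := complex_gaussian_box sa0 Ga.
have [cb cb0 hb] := complex_gaussian_box sb0 Gb.
exists (ca * cb); first by rewrite mulr_gt0.
move=> a b a0 b0 A mA boxA.
pose Q (a : R) : set (R * R) := `[a, (a + 1)%R]%classic `*` `[0%R, 1%R]%classic.
have mQ x : measurable (Q x) by apply: measurableX; exact: measurable_itv.
have mpre eta x : measurable_fun setT (re_im eta) -> measurable (re_im eta @^-1` Q x).
  by move=> m; rewrite -[_ @^-1` _]setTI; exact: m.
apply: (@le_trans _ _ (P (re_im al @^-1` Q a `&` re_im be @^-1` Q b))).
  rewrite ind// opprD expRD mulrACA EFinM.
  by apply: lee_pmul; rewrite ?lee_fin ?mulr_ge0 ?expR_ge0 ?(ltW ca0) ?(ltW cb0) ?ha ?hb.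
apply: le_measure; rewrite ?inE//; first by apply: measurableI; exact: mpre.
move=> w [[/= h1 h2] [/= h3 h4]]; apply: boxA; by rewrite in_itv/= in h1 h2 h3 h4 *.
Qed.
End gaussian_data.

Lemma powR_sqr {R : realType} (x p : R) : x `^ (2 * p) = (x `^ p) ^+ 2.
Proof. by rewrite mulrC powRrM powR_mulrn ?powR_ge0. Qed.

Lemma powR_split {R : realType} (x p : R) : 0 < x -> x `^ (1 - p) * x `^ p = x.
Proof.
move=> x0; rewrite -powRD ?subrK ?powRr1 ?(ltW x0)//.
by rewrite (gt_eqF x0) implybT.
Qed.

Lemma ln_mul_expR {R : realType} (c x : R) : 0 < c ->
  ln (c * expR (- x)) = ln c - x.
Proof. by move=> c0; rewrite lnM ?posrE ?expR_gt0// expRK. Qed.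

Lemma ln_le_mul_expR {R : realType} (p c x : R) : 0 < p -> 0 < c ->
  p <= c * expR (- x) -> ln p <= ln c - x.
Proof.
move=> p0 c0 pc; rewrite -ln_mul_expR// ler_ln ?posrE//.
by rewrite mulr_gt0// expR_gt0.
Qed.

Lemma mul_expR_le_ln {R : realType} (p c x : R) : 0 < p -> 0 < c ->
  c * expR (- x) <= p -> ln c - x <= ln p.
Proof.
move=> p0 c0 pc; rewrite -ln_mul_expR// ler_ln ?posrE//.
by rewrite mulr_gt0// expR_gt0.
Qed.

Section exceedance.
Context {R : realType} {d : measure_display} {T : measurableType d}.
Variables (P : probability T R) (z0 delta sa sb : R) (alpha beta : T -> R[i]).
Variables (u : R -> T -> R -> R -> R[i]) (t : R -> R).
Hypotheses (hz0 : 0 < z0) (hdelta : 0 < delta < 1) (hsa : 0 < sa) (hsb : 0 < sb).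
Hypotheses (halpha : complex_gaussian P sa alpha) (hbeta : complex_gaussian P sb beta).
Hypothesis hindep : independent_complex P alpha beta.
Hypothesis hu : forall (eps : R) (w : T), 0 < eps ->
  nls_solution (datum eps (alpha w) (beta w)) (u eps w).
Hypothesis ht0 : forall eps : R, 0 < eps -> 0 <= t eps.
Hypothesis ht : eps `^ (2 * (1 - delta)) * t eps @[eps --> 0^'+] --> (0 : R).

Let r eps := eps `^ (1 - delta).
Let s eps := eps `^ delta.
Let rate := z0 ^+ 2 / (sa ^+ 2 + sb ^+ 2).
Let exceed eps : set T := [set w | z0 * r eps <= sup_torus (u eps w (t eps))].

Let r_gt0 eps : 0 < eps -> 0 < r eps. Proof. exact: powR_gt0. Qed.
Let s_gt0 eps : 0 < eps -> 0 < s eps. Proof. exact: powR_gt0. Qed.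

Let measurable_exceed_eps eps : 0 < eps -> measurable (exceed eps).
Proof.
move=> e0; apply: measurable_exceed (ht0 e0) (fun w => hu w e0).
  by have [] := halpha.
by have [] := hbeta.
Qed.

Let s_cvg0 : s eps @[eps --> 0^'+] --> (0 : R).
Proof. by apply: powR_cvg0; case/andP: hdelta. Qed.

(* Here [r s = eps], [r^2] is the squared size of the relevant data, and
   [r^2 t] tends to 0 by assumption. *)
Let near_small (C k : R) : 0 < C -> 0 < k -> \forall eps \near (0 : R)^'+,
  [/\ 0 < eps, s eps <= 1, C * r eps ^+ 2 <= 1 & C * r eps ^+ 2 * t eps <= k].
Proof.
move=> C0 k0.
have r_cvg0 : r eps @[eps --> 0^'+] --> (0 : R).
  by apply: powR_cvg0; rewrite subr_gt0; case/andP: hdelta.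
have Cr : C * (r eps * r eps) @[eps --> 0^'+] --> C * (0 * 0).
  by apply: cvgM; [exact: cvg_cst|exact: cvgM].
have Crt : C * (eps `^ (2 * (1 - delta)) * t eps) @[eps --> 0^'+] --> C * 0.
  by apply: cvgM; [exact: cvg_cst|exact: ht].
rewrite !mulr0 in Cr Crt.
near=> eps; split.
- by near: eps; exact: nbhs_right_gt.
- by near: eps; exact: (cvgr_le _ s_cvg0).
- by rewrite expr2; near: eps; exact: (cvgr_le _ Cr).
- by rewrite -mulrA -powR_sqr; near: eps; exact: (cvgr_le _ Crt).
Unshelve. all: end_near. Qed.

Let exceed_upper (eta : R) : 0 < eta < 1 -> exists2 C, 0 < C &
  \forall eps \near (0 : R)^'+,
    (P (exceed eps) <= (C * expR (- ((1 - eta) ^+ 3 * rate / s eps ^+ 2)))%:E)%E.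
Proof.
move=> eta01; have /andP[eta0 eta1] := eta01.
have [k k0 large] := exceed_imp_large hz0 hsa hsb eta01.
have k1 : 0 < 1 - eta < 1 by apply/andP; split; lra.
have [C C0 tail] := data_tail hsa hsb k1 halpha hbeta hindep.
exists (C + 1); first by rewrite ltr_wpDl.
have z2 : 0 < 2 * z0 ^+ 2 by rewrite mulr_gt0// exprn_gt0.
apply: filterS (near_small z2 k0) => eps [e0 _ r1 rt].
have y0 : 0 <= (1 - eta) ^+ 2 * rate / s eps ^+ 2.
  by rewrite divr_ge0 ?sqr_ge0// mulr_ge0 ?sqr_ge0// divr_ge0 ?sqr_ge0// addr_ge0 ?sqr_ge0.
apply: le_trans (tail _ y0 _ (measurable_exceed_eps e0) _) _.
  move=> w ex; apply: (large (r eps) (s eps) (t eps)) (ex) => //.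
  - exact: r_gt0.
  - exact: s_gt0.
  - by rewrite powR_split//; exact: hu.
  - exact: ht0.
rewrite lee_fin exprS !mulrA; apply: ler_wpM2r; first exact: expR_ge0.
by rewrite lerDl.
Qed.

Let exceed_lower (e : R) : 0 < e -> exists2 c, 0 < c &
  \forall eps \near (0 : R)^'+,
    ((c * expR (- (((z0 + e) * sa ^+ 2 / (sa ^+ 2 + sb ^+ 2) / s eps + 1) ^+ 2 / sa ^+ 2
      + ((z0 + e) * sb ^+ 2 / (sa ^+ 2 + sb ^+ 2) / s eps + 1) ^+ 2 / sb ^+ 2)))%:E
     <= P (exceed eps))%E.
Proof.
move=> e0.
have S0 : 0 < sa ^+ 2 + sb ^+ 2 by rewrite addr_gt0// exprn_gt0.
set A := _ * sa ^+ 2 / _; set B := _ * sb ^+ 2 / _.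
have ze : 0 <= z0 + e by rewrite addr_ge0// ltW.
have A0 : 0 <= A by rewrite divr_ge0 ?(ltW S0)// mulr_ge0// sqr_ge0.
have B0 : 0 <= B by rewrite divr_ge0 ?(ltW S0)// mulr_ge0// sqr_ge0.
(* the split of [z0 + e] that minimises [A^2 / sa^2 + B^2 / sb^2] *)
have AB : A + B = z0 + e by rewrite /A /B; field; rewrite gt_eqF.
have [C [k [C0 k0 box]]] := box_imp_exceed A0 B0 e0.
have [c c0 low] := data_box hsa hsb halpha hbeta hindep.
exists c => //; apply: filterS (near_small C0 k0) => eps [eps0 s1 r1 rt].
have s0 := s_gt0 eps0.
apply: low; [by rewrite divr_ge0// ltW|by rewrite divr_ge0// ltW|exact: measurable_exceed_eps|].
move=> w h1 h2 h3 h4; rewrite /exceed/=.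
have -> : z0 = A + B - e by rewrite AB addrK.
apply: (box (r eps) (s eps) (t eps) (alpha w) (beta w)) => //.
- exact: r_gt0.
- by rewrite powR_split//; exact: hu.
- exact: ht0.
Qed.

(** The upper bound costs a factor [(1 - eta)^3] in the rate, the lower bound an
    increase of [z0] to [z0 + e1]; both can be made negligible, and the constants in
    front of the exponentials disappear after multiplication by [s ^+ 2]. *)
Lemma exceed_ldp :
  ((eps `^ (2 * delta))%:E * lne (P (exceed eps)))%E @[eps --> 0^'+] --> (- rate)%:E.
Proof.
have S0 : 0 < sa ^+ 2 + sb ^+ 2 by rewrite addr_gt0// exprn_gt0.
have rate0 : 0 < rate by rewrite divr_gt0// exprn_gt0.
have Pfin eps : 0 < eps -> P (exceed eps) = (fine (P (exceed eps)))%:E.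
  move=> e0; rewrite fineK// ge0_fin_numE ?measure_ge0//.
  by apply: le_lt_trans (probability_le1 P (measurable_exceed_eps e0)) _; rewrite ltry.
pose g eps : R := s eps ^+ 2 * ln (fine (P (exceed eps))).
have Pgt0 : \forall eps \near (0 : R)^'+, 0 < fine (P (exceed eps)).
  have [c c0 low] := exceed_lower ltr01.
  apply: filter_app low; near=> eps => low.
  have eps0 : 0 < eps by near: eps; exact: nbhs_right_gt.
  rewrite -lte_fin -Pfin//; apply: lt_le_trans low.
  by rewrite lte_fin mulr_gt0// expR_gt0.
apply: (@cvg_trans _ (EFin \o g @ (0 : R)^'+)).
  apply: near_eq_cvg; near=> eps.
  have eps0 : 0 < eps by near: eps; exact: nbhs_right_gt.
  have -> : lne (P (exceed eps)) = (ln (fine (P (exceed eps))))%:E.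
    by rewrite [in LHS]Pfin// lne_EFin//; near: eps.
  by rewrite -EFinM powR_sqr.
apply: cvg_EFin; first exact: nearW.
apply/cvgrPdist_le => e e0.
have s2_cvg0 (l : R) : s eps ^+ 2 * l @[eps --> 0^'+] --> (0 : R).
  have h : s eps * s eps * l @[eps --> 0^'+] --> 0 * 0 * l.
    by apply: cvgM; [exact: cvgM|exact: cvg_cst].
  by rewrite !mul0r in h; under eq_fun do rewrite expr2.
have upper : \forall eps \near (0 : R)^'+, g eps <= - rate + e.
  pose eta := Num.min (2^-1) (e / (6 * rate)).
  have eta0 : 0 < eta by rewrite lt_min invr_gt0 ltr0n/= divr_gt0// mulr_gt0.
  have eta_half : eta <= 2^-1 by rewrite ge_min lexx.
  have rate6 : 0 < 6 * rate by rewrite mulr_gt0.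
  have eta_e : eta * (6 * rate) <= e.
    by rewrite -ler_pdivlMr// ge_min lexx orbT.
  have eta01 : 0 < eta < 1 by rewrite eta0/=; lra.
  have [C C0 up] := exceed_upper eta01.
  have e2 : 0 < e / 2 by rewrite divr_gt0.
  have sC : \forall eps \near (0 : R)^'+, s eps ^+ 2 * ln C <= e / 2.
    exact: (cvgr_le _ (s2_cvg0 _)).
  near=> eps.
  have eps0 : 0 < eps by near: eps; exact: nbhs_right_gt.
  have s0 := s_gt0 eps0.
  have p0 : 0 < fine (P (exceed eps)) by near: eps.
  have : fine (P (exceed eps)) <= C * expR (- ((1 - eta) ^+ 3 * rate / s eps ^+ 2)).
    by rewrite -lee_fin -Pfin//; near: eps.
  move=> /(ln_le_mul_expR p0 C0) h.
  have := ler_wpM2l (sqr_ge0 (s eps)) h.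
  rewrite -/(g eps) mulrDr mulrN mulrCA divff ?mulr1 ?expf_neq0 ?gt_eqF// => /le_trans; apply.
  have sCe : s eps ^+ 2 * ln C <= e / 2 by near: eps.
  have : 1 - 3 * eta <= (1 - eta) ^+ 3.
    rewrite -subr_ge0.
    have -> : (1 - eta) ^+ 3 - (1 - 3 * eta) = eta ^+ 2 * (3 - eta) by ring.
    by rewrite mulr_ge0 ?sqr_ge0//; lra.
  move=> /(ler_wpM2r (ltW rate0)); lra.
have lower : \forall eps \near (0 : R)^'+, - rate - e <= g eps.
  pose Sg := sa ^+ 2 + sb ^+ 2.
  pose e1 := Num.min 1 (Sg * (e / 2) / (2 * z0 + 1)).
  have z1 : 0 < 2 * z0 + 1 by rewrite addr_gt0// mulr_gt0.
  have e10 : 0 < e1.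
    by rewrite lt_min ltr01/= divr_gt0// mulr_gt0// divr_gt0.
  have e1_1 : e1 <= 1 by rewrite ge_min lexx.
  have e1_e : e1 * (2 * z0 + 1) <= Sg * (e / 2).
    by rewrite -ler_pdivlMr// ge_min lexx orbT.
  have [c c0 low] := exceed_lower e10.
  set A := (z0 + e1) * sa ^+ 2 / _ in low; set B := (z0 + e1) * sb ^+ 2 / _ in low.
  have main_cvg : s eps ^+ 2 * ln c - ((A + s eps) ^+ 2 / sa ^+ 2 + (B + s eps) ^+ 2 / sb ^+ 2)
      @[eps --> 0^'+] --> 0 - ((A + 0) ^+ 2 / sa ^+ 2 + (B + 0) ^+ 2 / sb ^+ 2).
    apply: cvgB; first exact: s2_cvg0.
    have sq (x y : R) : (x + s eps) ^+ 2 / y @[eps --> 0^'+] --> (x + 0) ^+ 2 / y.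
      apply: cvgM; last exact: cvg_cst.
      have xs : x + s eps @[eps --> 0^'+] --> x + 0 by apply: cvgD => //; exact: cvg_cst.
      by under eq_fun do rewrite expr2; rewrite expr2; exact: cvgM.
    exact: cvgD.
  have limE : 0 - ((A + 0) ^+ 2 / sa ^+ 2 + (B + 0) ^+ 2 / sb ^+ 2) = - ((z0 + e1) ^+ 2 / Sg).
    by rewrite /A /B /Sg; field; rewrite !gt_eqF.
  rewrite limE in main_cvg.
  have lim_gt : - rate - e < - ((z0 + e1) ^+ 2 / Sg).
    rewrite ltrNr opprD !opprK ltr_pdivrMr//.
    have -> : (rate + e) * Sg = z0 ^+ 2 + e * Sg by rewrite /rate /Sg; field; rewrite gt_eqF.
    have : e1 ^+ 2 <= e1 by rewrite expr2 ler_piMl// ltW.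
    have : 0 < Sg * (e / 2) by rewrite mulr_gt0// divr_gt0.
    lra.
  have near_ge : \forall eps \near (0 : R)^'+, - rate - e <=
      s eps ^+ 2 * ln c - ((A + s eps) ^+ 2 / sa ^+ 2 + (B + s eps) ^+ 2 / sb ^+ 2).
    exact: (cvgr_ge _ main_cvg).
  near=> eps.
  have eps0 : 0 < eps by near: eps; exact: nbhs_right_gt.
  have s0 := s_gt0 eps0.
  have p0 : 0 < fine (P (exceed eps)) by near: eps.
  have : c * expR (- ((A / s eps + 1) ^+ 2 / sa ^+ 2 + (B / s eps + 1) ^+ 2 / sb ^+ 2))
      <= fine (P (exceed eps)).
    by rewrite -lee_fin -Pfin//; near: eps.
  move=> /(mul_expR_le_ln p0 c0) h.
  have := ler_wpM2l (sqr_ge0 (s eps)) h; rewrite -/(g eps); apply: le_trans.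
  have -> : s eps ^+ 2 * (ln c - ((A / s eps + 1) ^+ 2 / sa ^+ 2 + (B / s eps + 1) ^+ 2 / sb ^+ 2))
    = s eps ^+ 2 * ln c - ((A + s eps) ^+ 2 / sa ^+ 2 + (B + s eps) ^+ 2 / sb ^+ 2).
    by field; rewrite !gt_eqF.
  by near: eps.
near=> eps; rewrite ler_distlC; apply/andP; split.
  by near: eps; exact: lower.
by near: eps; exact: upper.
Unshelve. all: end_near. Qed.
End exceedance.

Unset Implicit Arguments.

Theorem proposition3p3 (R : realType) (d : measure_display)
  (T : measurableType d) (P : probability T R)
  (z0 delta sa sb : R) (alpha beta : T -> R[i])
  (u : R -> T -> R -> R -> R[i]) (t : R -> R)
  (hz0 : 0 < z0) (hdelta : 0 < delta < 1)
  (hsa : 0 < sa) (hsb : 0 < sb) (hsab : sb ^+ 2 < sa ^+ 2)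
  (halpha : complex_gaussian P sa alpha)
  (hbeta : complex_gaussian P sb beta)
  (hindep : independent_complex P alpha beta)
  (hu : forall (eps : R) (w : T), 0 < eps ->
     nls_solution
       (fun x => eps%:C * (alpha w * cexpi x + beta w * cexpi (- x)))
       (u eps w))
  (ht0 : forall eps : R, 0 < eps -> 0 <= t eps)
  (ht : eps `^ (2 * (1 - delta)) * t eps @[eps --> 0^'+] --> (0 : R)) :
  ((eps `^ (2 * delta))%:E *
     lne (P [set w | (z0 * eps `^ (1 - delta) <=
                      sup_torus (u eps w (t eps)))%R]))%E
    @[eps --> 0^'+] --> (- (z0 ^+ 2 / (sa ^+ 2 + sb ^+ 2)))%:E.
Proof.
exact: (exceed_ldp hz0 hdelta hsa hsb halpha hbeta hindep hu ht0 ht).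
Qed.
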